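(* Let $n\geq 3$ be an odd integer and let $m$ be an integer with $1\leq m\leq n-1$. If $f: G(n,2)\to\mathbb{R}^m$ is continuous, then the set $\{P\in G(n,2) : f(T(P))=f(P)\}$ is $T$-invariant and, with the restricted involution $T$, has Yang index at least $n-m-1$.
   Context: All homology is with $\mathbb{Z}_2$ coefficients. Grassmannian. $St(n,k)=\{(v_1,\ldots,v_k) : v_i\in\mathbb{R}^n,\ v_i\cdot v_j=\delta_{i,j}\}$, and $G(n,k)=St(n,k)/SO(k)$ (right action) is the Grassmannian of oriented $k$-planes through the origin in $\mathbb{R}^n$, with the free involution $T$ reversing the orientation of each $k$-plane. Yang index. A $T$-space is a pair $(X,T)$ with $X$ a compact Hausdorff space and $T$ a fixed-point free involution of $X$. It is simplicial if $X$ is a finite simplicial complex whose simplices are permuted by $T$. For simplicial $(X,T)$, an $m$-chain $c$ is $T$-invariant if $T(c)=c$, equivalently $c=d+T(d)$ for some $m$-chain $d$. Let $C_m(X,T)$ be the group of $T$-invariant $m$-chains; $\partial$ restricts to these, and $H_m(X,T)=Z_m(X,T)/B_m(X,T)$, where $Z_m(X,T)$ is the kernel of $\partial_m$ on $C_m(X,T)$ and $B_m(X,T)$ is the image of $C_{m+1}(X,T)$ under $\partial_{m+1}$. For $c=d+T(d)\in Z_0(X,T)$, the index $\nu(c)\in\mathbb{Z}_2$ is the parity of the number of vertices in $d$; for $c=d+T(d)\in Z_m(X,T)$ with $m\ge 1$, $\nu(c)=\nu(\partial d)$, inductively. This is independent of choices and gives a homomorphism $\nu:H_m(X,T)\to\mathbb{Z}_2$.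 For an arbitrary $T$-space, $H_m(X,T)$ and $\nu$ are defined in the Čech manner, i.e. as the inverse limit over the nerves of finite $T$-invariant open covers all of whose members $U$ satisfy $U\cap T(U)=\emptyset$ ($H_m(X,T)$ is isomorphic to the $m$-th Čech homology group of $X/T$). The Yang index $\nu(X,T)$ is the largest integer $m$ such that $\nu(H_m(X,T))\neq\{0\}$ (so having Yang index at least some $r\ge 0$ entails being nonempty). *)

(* Defs.v *)
From HB Require Import structures.
From mathcomp Require Import all_boot all_order all_algebra finmap.
From mathcomp Require Import generic_quotient.
From mathcomp Require Import all_classical all_reals all_analysis.

Set Implicit Arguments.
Unset Strict Implicit.
Unset Printing Implicit Defensive.

Import Order.TTheory GRing.Theory Num.Theory.
Import numFieldNormedType.Exports.

Local Open Scope classical_set_scope.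
Local Open Scope ring_scope.
Local Open Scope quotient_scope.

Section Grassmannian.
Variables (R : realType) (n k : nat).

(* The frame (v_1, ..., v_k) is the matrix whose columns are the v_i. *)
Definition Stiefel : set 'M[R]_(n, k) := [set v | v^T *m v = 1%:M].

Definition SO : set 'M[R]_k := [set g | g^T *m g = 1%:M /\ \det g = 1].

Definition same_SO_orbit (v w : Stiefel) : bool :=
  `[< exists2 g, SO g & \val w = \val v *m g >].

Lemma same_SO_orbit_equiv : equiv_class_of same_SO_orbit.
Proof.
split=> [v|v w|v u w].
- apply/asboolP; exists 1%:M; last by rewrite mulmx1.
  by split; rewrite ?trmx1 ?mulmx1 ?det1.
- suff sym a b : same_SO_orbit a b -> same_SO_orbit b a.
    by apply/idP/idP; exact: sym.
  move=> /asboolP[g [gg dg] ab]; apply/asboolP; exists g^T.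
    by split; rewrite ?det_tr// trmxK; exact: mulmx1C.
  by rewrite ab -mulmxA (mulmx1C gg) mulmx1.
- move=> /asboolP[g [gg dg] uv] /asboolP[h [hh dh] wu].
  apply/asboolP; exists (g *m h); last by rewrite wu uv mulmxA.
  split; last by rewrite det_mulmx dg dh mulr1.
  by rewrite trmx_mul mulmxA -(mulmxA h^T) gg mulmx1.
Qed.

Canonical same_SO_orbit_rel := EquivRelPack same_SO_orbit_equiv.

Definition Gr : topologicalType :=
  quotient_topology {eq_quot same_SO_orbit_rel}.

(* Right multiplication by flip_mx replaces v_1 by - v_1; since flip_mx is   *)
(* orthogonal of determinant -1 (for k > 0), this keeps the spanned plane    *)
(* and reverses its orientation.                                             *)
Definition flip_mx : 'M[R]_k :=
  diag_mx (\row_(i < k) (-1) ^+ ((i : nat) == 0%N)).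

Lemma flip_mxK : flip_mx *m flip_mx = 1%:M.
Proof.
apply/matrixP => i j; rewrite mul_diag_mx !mxE.
have [->|//] := eqVneq i j; last by rewrite mulr0n mulr0.
by rewrite !mulr1n -expr2 sqrr_sign.
Qed.

Lemma flip_mx_tr : flip_mx^T = flip_mx.
Proof. exact: tr_diag_mx. Qed.

Lemma det_flip_mx : (0 < k)%N -> \det flip_mx = -1.
Proof.
rewrite /flip_mx; case: k => // k' _; rewrite det_diag big_ord_recl.
by rewrite big1 ?mulr1 ?mxE// => i _; rewrite mxE.
Qed.

Lemma flip_subproof (v : Stiefel) : \val v *m flip_mx \in Stiefel.
Proof.
have /set_mem vS := valP v; apply/mem_set.
by rewrite /Stiefel/= trmx_mul mulmxA -(mulmxA flip_mx^T) vS mulmx1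
  flip_mx_tr flip_mxK.
Qed.

Definition flip (v : Stiefel) : Stiefel :=
  exist (fun w => w \in Stiefel) _ (flip_subproof v).

Definition GrT (P : Gr) : Gr := \pi_Gr (flip (repr P)).

Lemma GrT_pi (v : Stiefel) : GrT (\pi_Gr v) = \pi_Gr (flip v).
Proof.
have [g [gg dg] vg] : exists2 g, SO g & \val (repr (\pi_Gr v)) = \val v *m g.
  apply/asboolP.
  have /eqmodP : v = repr (\pi_Gr v) %[mod {eq_quot same_SO_orbit_rel}].
    by rewrite [RHS](@reprK _ Gr).
  by [].
apply/esym/eqmodP/asboolP => /=; exists (flip_mx *m g *m flip_mx).
  split; last first.
    by rewrite !det_mulmx dg mulr1 -det_mulmx flip_mxK det1.
  rewrite !trmx_mul flip_mx_tr !mulmxA -(mulmxA _ flip_mx flip_mx) flip_mxK.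
  by rewrite mulmx1 -(mulmxA flip_mx) gg mulmx1 flip_mxK.
by rewrite /= vg !mulmxA -(mulmxA (\val v) flip_mx flip_mx) flip_mxK mulmx1.
Qed.

Lemma GrTK : involutive GrT.
Proof.
move=> P; rewrite -[P](@reprK _ Gr) !GrT_pi; congr (\pi _).
by apply: val_inj; rewrite /= -mulmxA flip_mxK mulmx1.
Qed.

End Grassmannian.

(* A mod 2 chain on the vertex set V, given by its coefficients. *)
Definition chain (V : finType) := {ffun {set V} -> 'F_2}.

Section ChainOperations.
Variables V W : finType.

(* The guard removes the augmentation, so that boundaries of 0-chains vanish. *)
Definition boundary (c : chain V) : chain V :=
  [ffun s => if s == finset.set0 then 0
             else \sum_(s' : {set V} | (s \subset s') && (#|s'| == #|s|.+1))
                    c s'].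

(* Chain map of a vertex map; simplices with a degenerate image are sent to 0. *)
Definition chain_map (p : V -> W) (c : chain V) : chain W :=
  [ffun s => \sum_(s' : {set V} | (p @: s' == s) && (#|s'| == #|s|)) c s'].

End ChainOperations.

Section EquivariantHomology.
(* K is the set of (nonempty) simplices, t the involution on the vertices. *)
Variables (V : finType) (K : {set {set V}}) (t : V -> V).

Definition chains (m : nat) : {set chain V} :=
  [set c : chain V |
    [forall s, (c s != 0) ==> (s \in K) && (#|s| == m.+1)]]%SET.

Definition inv_chains (m : nat) : {set chain V} :=
  [set c in chains m | chain_map t c == c]%SET.

Definition inv_cycles (m : nat) : {set chain V} :=
  [set c in inv_chains m | boundary c == 0]%SET.

Definition inv_boundaries (m : nat) : {set chain V} :=
  [set boundary d | d in inv_chains m.+1]%SET.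

(* The elements of the quotient Z_m / B_m are the cosets of B_m in Z_m. *)
Definition hclass (m : nat) (c : chain V) : {set chain V} :=
  [set c + b | b in inv_boundaries m]%SET.

Definition inv_homology (m : nat) : {set {set chain V}} :=
  [set hclass m c | c in inv_cycles m]%SET.

(* [cycle_index m c a] : nu(c) = a, for an invariant m-cycle c; the choice of *)
(* d with c = d + T(d) is left free, as nu does not depend on it.             *)
Fixpoint cycle_index (m : nat) (c : chain V) (a : 'F_2) : Prop :=
  match m with
  | 0 => exists d, [/\ d \in chains 0, c = d + chain_map t d
                     & \sum_s d s = a]
  | m'.+1 => exists d, [/\ d \in chains m'.+1, c = d + chain_map t d
                         & cycle_index m' (boundary d) a]
  end.

Definition class_index (m : nat) (h : {set chain V}) (a : 'F_2) : Prop :=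
  exists2 c, c \in h & cycle_index m c a.

End EquivariantHomology.

Definition is_Tspace (X : topologicalType) (T : X -> X) : Prop :=
  [/\ compact [set: X], hausdorff_space X, continuous T, involutive T
    & forall x, T x <> x].

Section YangIndex.
Variables (X : topologicalType) (T : X -> X).

(* Finite T-invariant open covers; members are required to be nonempty, as    *)
(* the empty set is not a vertex of the nerve.                                *)
Record Tcover := TCover {
  members : {fset (set X)};
  member_open : forall A, A \in members -> open A;
  member_neq0 : forall A, A \in members -> A !=set0;
  members_cover : forall x, exists2 A, A \in members & A x;
  members_inv : forall A, A \in members -> T @` A \in members;
  member_free : forall A, A \in members -> A `&` T @` A = set0 }.

Definition vertex (u : Tcover) : finType := members u.

Definition vertexT (u : Tcover) (A : vertex u) : vertex u :=
  [` members_inv (valP A)]%fset.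

Definition nerve (u : Tcover) : {set {set vertex u}} :=
  [set s : {set vertex u} | (s != finset.set0) &&
     `[< exists x, forall A : vertex u, A \in s -> (\val A) x >]]%SET.

Definition nerve_homology (m : nat) (u : Tcover) : {set {set chain (vertex u)}} :=
  inv_homology (nerve u) (@vertexT u) m.

(* Equivariant refinement projections of v onto u. *)
Definition is_projection (u v : Tcover) (p : vertex v -> vertex u) : Prop :=
  (forall A, \val A `<=` \val (p A)) /\
  (forall A, p (vertexT A) = vertexT (p A)).

Definition induced_map (m : nat) (u v : Tcover) (p : vertex v -> vertex u)
    (h : {set chain (vertex v)}) : {set chain (vertex u)} :=
  [set chain_map p c + b |
    c in h, b in inv_boundaries (nerve u) (@vertexT u) m]%SET.

(* H_m(X, T): the inverse limit of the H_m of the nerves. *)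
Definition cech_homology (m : nat) :
    set (forall u : Tcover, {set chain (vertex u)}) :=
  [set h | (forall u, h u \in nerve_homology m u) /\
           (forall u v (p : vertex v -> vertex u), is_projection p ->
              induced_map m p (h v) = h u)].

(* nu on the inverse limit is the nu of the component at any cover. *)
Definition cech_index (m : nat) (h : forall u : Tcover, {set chain (vertex u)})
    (a : 'F_2) : Prop :=
  exists u, class_index (nerve u) (@vertexT u) m (h u) a.

Definition index_nontrivial (m : nat) : Prop :=
  exists2 h, cech_homology m h & exists2 a, cech_index m h a & a != 0.

Definition is_Yang_index (k : nat) : Prop :=
  index_nontrivial k /\ forall m, index_nontrivial m -> (m <= k)%N.

End YangIndex.

Section Restriction.
Variables (X : topologicalType) (T : X -> X) (Z : set X) (TZ : T @` Z = Z).

Lemma restrict_subproof (x : Z) : T (\val x) \in Z.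
Proof.
have Zx := set_mem (valP x); apply/mem_set.
by rewrite -[X in X _]TZ; exists (\val x).
Qed.

Definition restrictT (x : Z) : Z :=
  exist (fun y => y \in Z) _ (restrict_subproof x).

End Restriction.

(* Main.v *)
From HB Require Import structures.
Require Import Defs.
From mathcomp Require Import all_boot all_order all_algebra.
From mathcomp Require Import finmap generic_quotient ring lra zify.

(* The Pluecker coordinates embed the Grassmannian equivariantly into a space *)
(* of matrices with the antipodal map, which gives an invariant metric.       *)
(*                                                                            *)
(* Test cycle.  Let X be the bundle of unit spheres orthogonal to r e_0 over  *)
(* the path of rotations r of the plane (e_0, e_1) by angles from 0 to pi,    *)
(* mapped to G(n,2) by (r, y) |-> span (r e_0, r y).  With D_k the half       *)
(* spheres of the fibre, chains E_i built from the D_k satisfy                *)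
(* bd E_(i+1) = E_i + T E_i, with E_0 a point: E_i is the sweep of D_(i-1)    *)
(* along the path, plus D_i itself when i < n-1 is even.  This uses           *)
(* that n is odd, and yields arbitrarily fine invariant (n-1)-cycles of index *)
(* one.  (Geometrically, the Schubert variety of the planes meeting a fixed   *)
(* plane has odd degree n - 2.)                                               *)
(*                                                                            *)
(* Yang's reduction.  An odd function cuts an invariant d-cycle of index one  *)
(* down to an invariant (d-1)-cycle of index one on which it is small.  The m *)
(* coordinates of f (T P) - f P thus produce fine cycles of dimension n-1-m   *)
(* near the zero set Z, which map simplicially to the nerve of any cover of Z *)
(* by compactness.  An ultrafilter on the covers turns these classes into an  *)
(* element of the inverse limit.  In degrees at least the number of vertices  *)
(* of one cover the index vanishes, so that the Yang index exists.            *)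

Set Implicit Arguments.
Unset Strict Implicit.
Unset Printing Implicit Defensive.

Import Order.TTheory GRing.Theory Num.Theory.

Local Open Scope ring_scope.

(** * Chains of tuples and prisms *)

(** Write h = f T - f, an odd map to R^m whose zero set is Z. Cutting a T-space by the zero set of
    one odd real function lowers the Yang index by at most one, so the claim reduces to finding
    cycles of index one in dimension n - 1 on the whole Grassmannian. The index of c = d + T d is
    read off from the boundary of d, so a ladder of chains with bd E_(i+1) = E_i + T E_i and E_0 a
    single point exhibits E_N + T E_N as an invariant cycle of index one ([ladder_cycle]).
    [Gr_ladder] builds such ladders of arbitrarily small mesh with N = n - 1.

    In that construction a half sphere of dimension k is swept along a path of rotations from 0 to
    pi. Below the top dimension n - 2 the two end copies differ by T; in the top dimension they
    coincide. The corrections that absorb the end copies alternate with the parity of k, and they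
    agree with the top dimension because n - 2 is odd.

    The reduction takes place on finite complexes of small simplices: [index_reduction], repeated by
    [iterated_reduction], leaves a cycle of dimension n - 1 - m near Z, and [cover_cycle] maps it to
    the nerve of a given cover of Z. Contiguous equivariant maps are homologous
    ([contiguous_homologous]), so the choice of refinement projections does not matter, and
    compactness of an inverse system of finite sets gives an element of the limit
    ([index_nontrivial_of]). With the bound of [index_nontrivial_bound] on the degree, [yang]
    obtains the maximum that defines the Yang index. *)

Lemma addF2 (x : 'F_2) : x + x = 0.
Proof. by rewrite -mulr2n -mulr_natr (pchar_Zp (isT : (1 < 2)%N)) ?mulr0. Qed.

Lemma eqF2 (x y : 'F_2) : x + y = 0 -> x = y.
Proof. by move=> xy; rewrite -[LHS]addr0 -(addF2 y) addrA xy add0r. Qed.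

Section TupleChains.
Variable Y : Type.
Implicit Types (F : seq Y -> 'F_2) (s : seq Y) (l : seq (seq Y)).

(* A list of tuples stands for their sum mod 2; two lists are the same chain *)
(* when all cochains agree on them.                                          *)
Definition ev F l : 'F_2 := \sum_(s <- l) F s.
Definition eqc l1 l2 := forall F, ev F l1 = ev F l2.

Lemma ev_nil F : ev F [::] = 0. Proof. exact: big_nil. Qed.
Lemma ev_cons F s l : ev F (s :: l) = F s + ev F l. Proof. exact: big_cons. Qed.
Lemma ev_cat F l1 l2 : ev F (l1 ++ l2) = ev F l1 + ev F l2.
Proof. exact: big_cat. Qed.

Lemma ev_flatten (X : Type) F (f : X -> seq (seq Y)) (l : seq X) :
  ev F (flatten (map f l)) = \sum_(s <- l) ev F (f s).
Proof. by rewrite /ev big_flatten /= big_map. Qed.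

(** A one-point tuple has the empty tuple as its face. This augmentation keeps the recursion
    uniform; [simp] later sends the empty tuple to zero. *)
Fixpoint faces s : seq (seq Y) :=
  if s is x :: s' then s' :: map (cons x) (faces s') else [::].

Definition bd l := flatten (map faces l).

Lemma ev_bd F l : ev F (bd l) = ev (fun s => ev F (faces s)) l.
Proof. exact: ev_flatten. Qed.

Lemma ev_faces_cons F x s :
  ev F (faces (x :: s)) = F s + ev (fun r => F (x :: r)) (faces s).
Proof. by rewrite /= ev_cons /ev big_map. Qed.

Lemma bd_bd F s : ev F (bd (faces s)) = 0.
Proof.
elim: s F => [|x s IH] F; first by rewrite ev_nil.
rewrite ev_bd ev_faces_cons.
under [X in _ + X]eq_bigr do rewrite ev_faces_cons.
rewrite big_split /= addrA addF2 add0r.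
by move: (IH (fun r => F (x :: r))); rewrite ev_bd.
Qed.

End TupleChains.

Local Notation "l1 === l2" := (eqc l1 l2) (at level 70).

(** * The prism operator modulo 2 *)

Section Maps.
Variables (Y W : Type).
Implicit Types (s : seq Y) (l : seq (seq Y)) (a b : Y -> W) (F : seq W -> 'F_2).

Definition mp a l := map (map a) l.

Lemma ev_mp F a l : ev F (mp a l) = ev (fun s => F (map a s)) l.
Proof. by rewrite /ev big_map. Qed.

Lemma faces_map a s : faces (map a s) = mp a (faces s).
Proof. by elim: s => //= x s ->; rewrite /mp -!map_comp. Qed.

Lemma bd_mp a l : bd (mp a l) = mp a (bd l).
Proof.
rewrite /mp /bd map_flatten -!map_comp; congr flatten.
by apply: eq_map => s /=; rewrite faces_map.
Qed.

Lemma mp_cat a l1 l2 : mp a (l1 ++ l2) = mp a l1 ++ mp a l2.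
Proof. exact: map_cat. Qed.

(** The standard triangulated prism: the tuples a x_0, ..., a x_i, b x_i, ..., b x_k for all i. *)
Fixpoint pr a b s : seq (seq W) :=
  if s is x :: s' then
    [:: a x, b x & map b s'] :: map (cons (a x)) (pr a b s')
  else [::].

Definition prism a b l := flatten (map (pr a b) l).

Lemma ev_prism F a b l : ev F (prism a b l) = ev (fun s => ev F (pr a b s)) l.
Proof. exact: ev_flatten. Qed.

Lemma ev_pr_cons F a b x s : ev F (pr a b (x :: s)) =
  F [:: a x, b x & map b s] + ev (fun r => F (a x :: r)) (pr a b s).
Proof. by rewrite /= ev_cons /ev big_map. Qed.

(** The prism over [x :: s] is one new tuple plus the cone with apex [a x] over the prism of [s]; by
    induction all inner terms cancel in pairs. *)
Lemma pr_bd F a b s :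
  ev F (bd (pr a b s)) + ev F (prism a b (faces s)) =
  F (map a s) + F (map b s).
Proof.
elim: s F => [|x s IH] F; first by rewrite !ev_nil addr0 addF2.
rewrite ev_bd ev_prism ev_pr_cons !ev_faces_cons.
under [ev (fun r => ev F (faces _)) _]eq_bigr do rewrite ev_faces_cons.
under [ev (fun r => ev F (pr a b (x :: r))) _]eq_bigr do rewrite ev_pr_cons.
rewrite !big_split /= faces_map ev_mp.
move: (IH (fun r => F (a x :: r))); rewrite ev_bd ev_prism.
rewrite -![\sum_(i <- pr a b s) F i]/(ev F (pr a b s)).
rewrite /ev; set p := F (a x :: map a s).
set q := F (b x :: map b s); set r := F (a x :: map b s).
set t := \sum_(i <- pr a b s) F i.
set u := \sum_(i <- faces s) F _; set v := \sum_(i <- pr a b s) _.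
set z := \sum_(i <- faces s) _ => E.
apply: eqF2; transitivity ((v + z + (p + r)) +
  ((q + q) + (t + t) + (u + u))); first ring.
by rewrite !addF2 !addr0 E addF2.
Qed.


Lemma bd_prism a b l :
  bd (prism a b l) ++ prism a b (bd l) === mp a l ++ mp b l.
Proof.
move=> F; rewrite !ev_cat ev_bd !ev_prism ev_bd !ev_mp /ev -!big_split /=.
by apply: eq_bigr => s _; rewrite -pr_bd ev_bd ev_prism.
Qed.

Lemma prism_eqc a b l1 l2 : l1 === l2 -> prism a b l1 === prism a b l2.
Proof. by move=> e F; rewrite !ev_prism e. Qed.

Lemma prism_cat a b l1 l2 : prism a b (l1 ++ l2) = prism a b l1 ++ prism a b l2.
Proof. by rewrite /prism map_cat flatten_cat. Qed.

Lemma mp_eqc a l1 l2 : l1 === l2 -> mp a l1 === mp a l2.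
Proof. by move=> e F; rewrite !ev_mp e. Qed.

End Maps.

Section Sweep.
Variables (I Y W : Type) (g : I -> Y -> W).
Implicit Types (l : seq (seq Y)) (i : I) (p : seq I).

(* The homotopy along the path i :: p of parameters, as a sum of prisms. *)
Fixpoint sweep i p l : seq (seq W) :=
  if p is j :: p' then prism (g i) (g j) l ++ sweep j p' l else [::].

Lemma bd_sweep i p l :
  bd (sweep i p l) ++ sweep i p (bd l) === mp (g i) l ++ mp (g (last i p)) l.
Proof.
elim: p i => [|j p IH] i F /=.
  by rewrite [RHS]ev_cat [RHS]addF2 ev_nil.
have := IH j F; have := bd_prism (g i) (g j) l F.
rewrite /bd map_cat flatten_cat -!/(bd _) !ev_cat => E1 E2.
rewrite addrACA E1 E2 addrACA.
by rewrite -[RHS]addr0 -(addF2 (ev F (mp (g j) l))); ring.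
Qed.

Lemma sweep_eqc i p l1 l2 : l1 === l2 -> sweep i p l1 === sweep i p l2.
Proof.
move=> e; elim: p i => [|j p IH] i F //=.
by rewrite !ev_cat IH; congr (_ + _); exact: prism_eqc.
Qed.

Lemma sweep_cat i p l1 l2 :
  sweep i p (l1 ++ l2) === sweep i p l1 ++ sweep i p l2.
Proof.
elim: p i => [|j p IH] i F //=.
by rewrite prism_cat !ev_cat IH ev_cat; ring.
Qed.

End Sweep.

Section Equivariance.
Variables (Y : eqType) (W Y' W' : Type) (f : Y -> Y') (h : W -> W').

Lemma pr_equi (a b : Y -> W) (a' b' : Y' -> W') s :
  {in s, forall y, h (a y) = a' (f y)} -> {in s, forall y, h (b y) = b' (f y)} ->
  mp h (pr a b s) = pr a' b' (map f s).
Proof.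
elim: s => //= x s IH ea eb; rewrite ea ?mem_head// eb ?mem_head// -IH.
- congr ([:: _, _ & _] :: _).
    by rewrite -!map_comp; apply/eq_in_map => y ys; apply: eb; rewrite inE ys orbT.
  by rewrite /mp -!map_comp; apply: eq_map => r /=; rewrite ea ?mem_head.
- by move=> y ys; apply: ea; rewrite inE ys orbT.
- by move=> y ys; apply: eb; rewrite inE ys orbT.
Qed.

Lemma sweep_equi I (g : I -> Y -> W) (g' : I -> Y' -> W') i p l :
  (forall i y, h (g i y) = g' i (f y)) ->
  mp h (sweep g i p l) = sweep g' i p (mp f l).
Proof.
move=> e; elim: p i => //= j p IH i; rewrite mp_cat IH; congr (_ ++ _).
rewrite /prism /mp map_flatten -!map_comp; congr flatten; apply: eq_map => s /=.
by apply: pr_equi => y _.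
Qed.

End Equivariance.

Lemma eqc_trans Y (l2 l1 l3 : seq (seq Y)) : l1 === l2 -> l2 === l3 -> l1 === l3.
Proof. by move=> e1 e2 F; rewrite e1. Qed.

Lemma bd_cat Y (l1 l2 : seq (seq Y)) : bd (l1 ++ l2) = bd l1 ++ bd l2.
Proof. by rewrite /bd map_cat flatten_cat. Qed.

Section Sizes.
Variables (Y W : eqType).

Lemma faces_subseq (s r : seq Y) : r \in faces s -> subseq r s.
Proof.
elim: s r => //= x s IH r; rewrite inE => /orP[/eqP ->|/mapP[r' /IH rs ->]].
  exact: subseq_cons.
by rewrite /= eqxx.
Qed.

Lemma pr_size (a b : Y -> W) s r : r \in pr a b s -> size r = (size s).+1.
Proof.
elim: s r => //= x s IH r; rewrite inE => /orP[/eqP ->|/mapP[r' /IH e ->]] /=.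
  by rewrite size_map.
by rewrite e.
Qed.

Lemma pr_mem (a b : Y -> W) s r z : r \in pr a b s -> z \in r ->
  exists2 x, x \in s & z = a x \/ z = b x.
Proof.
elim: s r z => //= x s IH r z; rewrite inE => /orP[/eqP ->|/mapP[r' rs ->]].
  rewrite !inE => /or3P[/eqP ->|/eqP ->|/mapP[y ys ->]].
  - by exists x; [exact: mem_head|left].
  - by exists x; [exact: mem_head|right].
  - by exists y; [rewrite inE ys orbT|right].
rewrite inE => /orP[/eqP ->|/(IH _ _ rs)[y ys e]].
  by exists x; [exact: mem_head|left].
by exists y; [rewrite inE ys orbT|].
Qed.

End Sizes.

(** * Simplicial chains *)

Lemma addcc (V : finType) (c : chain V) : c + c = 0.
Proof. by apply/ffunP => s; rewrite !ffunE addF2. Qed.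

Lemma oppc (V : finType) (c : chain V) : - c = c.
Proof. by rewrite -[LHS]addr0 -(addcc c) addKr. Qed.

Lemma eqcc (V : finType) (c d : chain V) : c + d = 0 -> c = d.
Proof. by move=> /eqP; rewrite addr_eq0 oppc => /eqP. Qed.

Section Additivity.
Variables V W : finType.

Lemma boundary_additive : zmod_morphism (@boundary V).
Proof.
move=> c d; apply/ffunP => s; rewrite !ffunE.
case: eqP => _; first by rewrite subr0.
by rewrite -sumrB; apply: eq_bigr => i _; rewrite !ffunE.
Qed.

HB.instance Definition _ :=
  GRing.isZmodMorphism.Build (chain V) (chain V) (@boundary V)
    boundary_additive.

Lemma chain_map_additive (p : V -> W) : zmod_morphism (chain_map p).
Proof.
move=> c d; apply/ffunP => s; rewrite !ffunE.
by rewrite -sumrB; apply: eq_bigr => i _; rewrite !ffunE.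
Qed.

HB.instance Definition _ (p : V -> W) :=
  GRing.isZmodMorphism.Build (chain V) (chain W) (chain_map p)
    (chain_map_additive p).

Variable G : {set V} -> chain W.

Definition lin (c : chain V) : chain W := [ffun A => \sum_s c s * G s A].

Lemma lin_additive : zmod_morphism lin.
Proof.
move=> c d; apply/ffunP => A; rewrite !ffunE -sumrB.
by apply: eq_bigr => s _; rewrite !ffunE mulrBl.
Qed.

HB.instance Definition _ :=
  GRing.isZmodMorphism.Build (chain V) (chain W) lin lin_additive.

End Additivity.

Section Simplices.
Variable V : finType.
Implicit Types (l : seq V) (c : chain V).

(* Zero on degenerate tuples and, so that augmentations disappear, on [::]. *)
Definition simp l : chain V :=
  [ffun A => ((l != [::]) && uniq l && (A == [set x in l]))%:R].

Lemma simp_nonuniq l : ~~ uniq l -> simp l = 0.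
Proof. by move=> /negPf nu; apply/ffunP => A; rewrite !ffunE nu andbF. Qed.

Lemma simp_nil : simp [::] = 0.
Proof. by apply/ffunP => A; rewrite !ffunE. Qed.

Lemma simp_perm l1 l2 : perm_eq l1 l2 -> simp l1 = simp l2.
Proof.
move=> e; apply/ffunP => A; rewrite !ffunE (perm_uniq e).
have -> : [set x in l1] = [set x in l2].
  by apply/setP => x; rewrite !inE (perm_mem e).
by rewrite -!size_eq0 (perm_size e).
Qed.

Lemma simp_enumE (s A : {set V}) :
  simp (enum s) A = ((s != set0) && (A == s))%:R.
Proof.
rewrite ffunE enum_uniq andbT.
have -> : [set x in enum s] = s by apply/setP => x; rewrite inE mem_enum.
by rewrite -size_eq0 -cardE cards_eq0.
Qed.

Lemma chainE c : c set0 = 0 -> c = \sum_(s | c s != 0) simp (enum s).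
Proof.
move=> c0; apply/ffunP => A; rewrite sum_ffunE.
have [cA|cA] := eqVneq (c A) 0.
  rewrite cA big1// => s cs; rewrite simp_enumE.
  by have [As|] := eqVneq A s; rewrite ?andbF// -As cA eqxx in cs *.
rewrite (bigD1 A)//= big1 => [|s /andP[_ sA]]; last first.
  by rewrite simp_enumE [A == s]eq_sym (negPf sA) andbF.
have A0 : A != set0 by apply: contraNneq cA => ->; rewrite c0.
rewrite simp_enumE eqxx A0 addr0.
by case: (c A) cA => [[|[|//]]] i // _; apply/val_inj.
Qed.

Lemma faces_uniq l : uniq l -> faces l = [seq rem x l | x <- l].
Proof.
elim: l => //= x l IH /andP[xl ul]; rewrite eqxx IH// -map_comp; congr (_ :: _).
apply/eq_in_map => y yl /=; case: eqP => // xy.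
by rewrite xy yl in xl.
Qed.

(** Deleting either of two equal entries gives the same face up to order, and these two cancel;
    every other face is still degenerate. *)
Lemma sum_faces_nonuniq (A : zmodType) (F : seq V -> A) l :
  (forall x : A, x + x = 0) ->
  (forall l, ~~ uniq l -> F l = 0) ->
  (forall l1 l2, perm_eq l1 l2 -> F l1 = F l2) ->
  ~~ uniq l -> \sum_(r <- faces l) F r = 0.
Proof.
move=> A2; elim: l F => //= x l IH F F0 Fp; rewrite negb_and negbK.
rewrite big_cons big_map; have [ul|nl] := boolP (uniq l); last first.
  move=> _; rewrite (F0 _ nl) add0r; apply: IH => //.
  - by move=> r nr; apply: F0; rewrite /= negb_and nr orbT.
  - by move=> r s rs; apply: Fp; rewrite perm_cons.
rewrite orbF => xl; rewrite faces_uniq// big_map (bigD1_seq x)//=.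
rewrite (Fp (x :: rem x l) l) ?addrA ?A2 ?add0r; last first.
  by rewrite perm_sym perm_to_rem.
rewrite big_seq_cond big1// => y /andP[yl yx]; apply: F0 => /=.
by rewrite negb_and negbK mem_rem_uniq// inE /= eq_sym yx xl.
Qed.

(** Because this includes degenerate tuples, prisms and sweeps can be formed without controlling
    repeated vertices. *)
Lemma boundary_simp l : boundary (simp l) = \sum_(r <- faces l) simp r.
Proof.
have [ul|nl] := boolP (uniq l); last first.
  rewrite simp_nonuniq// raddf0 sum_faces_nonuniq//.
  - exact: addcc.
  - exact: simp_nonuniq.
  - exact: simp_perm.
have [->|l0] := eqVneq l [::].
  by rewrite simp_nil raddf0 big_nil.
apply/ffunP => A; rewrite sum_ffunE ffunE.
case: eqP => [->|/eqP A0].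
  rewrite big1// => r _; rewrite ffunE; case: r => //= x r.
  case: eqP => [/setP/(_ x)|]; last by rewrite andbF.
  by rewrite !inE eqxx.
set L := [set x in l].
transitivity (((A \subset L) && (#|L| == #|A|.+1))%:R : 'F_2).
  rewrite big_mkcond (bigD1 L)//= big1 => [|s sL]; rewrite !ffunE.
    by rewrite l0 ul eqxx /= addr0; case: ifP.
  by rewrite (negPf sL) andbF; case: ifP.
rewrite faces_uniq// big_map.
transitivity (\sum_(x <- l) ((A == L :\ x)%:R : 'F_2)); last first.
  apply: eq_big_seq => x xl; rewrite ffunE rem_uniq// andbT.
  have eL : [set y in rem x l] = L :\ x.
    by apply/setP => y; rewrite !inE mem_rem_uniq// inE.
  rewrite eL.
  case: (A =P L :\ x) => [e|]; rewrite ?andbF// andbT.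
  case e' : (rem x l) => [|//]; case/negP: A0.
  by rewrite e -eL e'; apply/eqP/setP => y; rewrite !inE.
rewrite big_uniq//=.
have [/andP[AL cA]|nA] := boolP (_ && _).
  have /cards1P[x0 e] : #|L :\: A| == 1%N.
    by rewrite cardsD (setIidPr AL) (eqP cA) subSnn.
  have /setDP[x0L x0A] : x0 \in L :\: A by rewrite e set11.
  have Ae : A = L :\ x0.
    apply/setP => y; rewrite !inE.
    move/setP/(_ y): e; rewrite !inE; have := subsetP AL y; rewrite inE.
    case: (y \in A); case: (y \in l); case: (y == x0) => //= /(_ isT) //.
  rewrite (bigD1 x0)//=; last by rewrite inE in x0L.
  rewrite Ae eqxx big1 ?addr0// => x /andP[xl xx0].
  case: eqP => // /setP/(_ x); rewrite !inE eqxx xl xx0 //=.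
rewrite big1// => x xl; case: eqP => // e; case/negP: nA; rewrite e.
by rewrite subsetDl /= (cardsD1 x L) inE xl.
Qed.

End Simplices.

Section ChainMaps.
Variables V W : finType.
Implicit Types (p : V -> W) (l : seq V) (c : chain V).

Lemma chain_map_simp p l : chain_map p (simp l) = simp (map p l).
Proof.
apply/ffunP => A; rewrite !ffunE.
have -> : map p l != [::] = (l != [::]) by case: l.
have -> : [set y in map p l] = p @: [set x in l].
  apply/setP => y; rewrite inE; apply/mapP/imsetP => -[x xl ->];
  by exists x; rewrite // inE in xl *.
have [l0|] := boolP (l != [::]); last first.
  move=> l0; rewrite big1// => s _.
  by rewrite ffunE (negPf l0).
have [ul|nul] := boolP (uniq l); last first.
  rewrite big1 => [|s _]; last by rewrite ffunE (negPf nul) andbF.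
  case: (boolP (uniq (map p l))) => // /map_uniq ul.
  by rewrite ul in nul.
set L := [set x in l].
have cL : #|L| = size l by rewrite -(card_uniqP ul); apply: eq_card => x; rewrite inE.
rewrite big_mkcond (bigD1 L)//= big1 => [|s sL]; rewrite !ffunE; last first.
  by rewrite (negPf sL) andbF; case: ifP.
rewrite l0 ul eqxx /= addr0 eq_sym.
have -> : uniq (map p l) = (#|p @: L| == #|L|).
  rewrite cL; apply/idP/idP => [/card_uniqP|/eqP e].
    rewrite size_map => <-; apply/eqP/eq_card => y.
    apply/imsetP/mapP => -[x xl ->]; by exists x; rewrite // inE in xl *.
  apply/card_uniqP; rewrite size_map -e; apply/eq_card => y.
  apply/mapP/imsetP => -[x xl ->]; by exists x; rewrite // inE in xl *.
have [->|] := eqVneq A (p @: L); last by rewrite andbF.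
by rewrite andbT /= eq_sym; case: (_ == _).
Qed.

End ChainMaps.

Section ChainIdentities.
Variables V W X : finType.
Implicit Types (p : V -> W) (q : W -> X) (c : chain V).

(** Reduces identities between chain operators to tuples. The condition at [set0] is there because
    no [simp l] has a component on the empty simplex. *)
Lemma additive_eq (A : zmodType) (f g : {additive chain V -> A}) c :
  c set0 = 0 -> (forall l, uniq l -> f (simp l) = g (simp l)) -> f c = g c.
Proof.
move=> /chainE E e; rewrite {1 2}E !raddf_sum.
by apply: eq_bigr => s _; rewrite e// enum_uniq.
Qed.

Lemma boundary_boundary c : c set0 = 0 -> boundary (boundary c) = 0.
Proof.
move=> c0.
have := @additive_eq _ (@boundary V \o @boundary V) \0 c c0; apply.
move=> l _ /=; rewrite boundary_simp raddf_sum.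
apply/ffunP => A; rewrite sum_ffunE [RHS]ffunE.
rewrite -[RHS](bd_bd (fun r => simp r A) l) ev_bd /ev; apply: eq_bigr => r _.
by rewrite /= boundary_simp sum_ffunE.
Qed.

Lemma chain_map_boundary p c :
  c set0 = 0 -> boundary (chain_map p c) = chain_map p (boundary c).
Proof.
move=> c0.
have := @additive_eq _ (@boundary W \o chain_map p)
  (chain_map p \o @boundary V) c c0; apply.
move=> l _ /=; rewrite chain_map_simp !boundary_simp raddf_sum.
rewrite faces_map big_map; apply: eq_bigr => r _.
by rewrite /= chain_map_simp.
Qed.

Lemma chain_map_comp p q c :
  c set0 = 0 -> chain_map q (chain_map p c) = chain_map (q \o p) c.
Proof.
move=> c0.
have := @additive_eq _ (chain_map q \o chain_map p) (chain_map (q \o p)) c c0.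
by apply => l _ /=; rewrite !chain_map_simp map_comp.
Qed.

End ChainIdentities.

Lemma chain_map_id (V : finType) (p : V -> V) (c : chain V) :
  p =1 id -> c set0 = 0 -> chain_map p c = c.
Proof.
move=> pid c0; have := @additive_eq _ _ (chain_map p) idfun c c0; apply.
by move=> l _; rewrite /= chain_map_simp (eq_map pid) map_id.
Qed.

Section TupleToChain.
Variable V : finType.
Implicit Types l : seq (seq V).

Definition tau l : chain V := \sum_(s <- l) simp s.

Lemma tau_eqc l1 l2 : l1 === l2 -> tau l1 = tau l2.
Proof.
by move=> e; apply/ffunP => A; rewrite !sum_ffunE; exact: (e (fun s => simp s A)).
Qed.

Lemma tau_cat l1 l2 : tau (l1 ++ l2) = tau l1 + tau l2.
Proof. exact: big_cat. Qed.

Lemma boundary_tau l : boundary (tau l) = tau (bd l).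
Proof.
rewrite /tau raddf_sum big_flatten big_map.
by apply: eq_bigr => s _; rewrite /= boundary_simp.
Qed.

Lemma chain_map_tau (W : finType) (p : V -> W) l :
  chain_map p (tau l) = \sum_(s <- mp p l) simp s.
Proof.
rewrite /tau raddf_sum big_map.
by apply: eq_bigr => s _; rewrite /= chain_map_simp.
Qed.

End TupleToChain.

(** * The index of invariant cycles *)

Lemma additive_eq_supp (V : finType) (A : zmodType)
    (f g : {additive chain V -> A}) (c : chain V) :
  c set0 = 0 ->
  (forall s, c s != 0 -> f (simp (enum s)) = g (simp (enum s))) -> f c = g c.
Proof.
move=> /chainE E e; rewrite {1 2}E !raddf_sum.
by apply: eq_bigr => s cs; rewrite e.
Qed.

Section TComplex.
Variables (V : finType) (K : {set {set V}}) (t : V -> V).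

(** That no simplex is mapped to itself means that the involution is free on the geometric
    realization; with closure under faces it also keeps x and t x out of a common simplex. *)
Record Tcomplex : Prop := {
  tcK : involutive t;
  tc_inv : forall s : {set V}, s \in K -> t @: s \in K;
  tc_face : forall s r : {set V}, s \in K -> r \subset s -> r != set0 -> r \in K;
  tc_free : forall s : {set V}, s \in K -> t @: s != s;
  tc_neq0 : set0 \notin K }.

Lemma chainsP m (c : chain V) :
  reflect (forall s, c s != 0 -> s \in K /\ #|s| = m.+1) (c \in chains K m).
Proof.
rewrite inE; apply: (iffP forallP) => H s.
  by move=> cs; have /implyP/(_ cs)/andP[? /eqP] := H s.
by apply/implyP => /H[-> ->]; rewrite eqxx.
Qed.

Lemma chains_set0 m c : c \in chains K m -> c set0 = 0.
Proof.
move=> /chainsP H; apply/eqP; apply/negPn/negP => /H[_].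
by rewrite cards0.
Qed.

Lemma chains0 m : 0 \in chains K m.
Proof. by apply/chainsP => s; rewrite ffunE eqxx. Qed.

Lemma chainsD m c d :
  c \in chains K m -> d \in chains K m -> c + d \in chains K m.
Proof.
move=> /chainsP cm /chainsP dm; apply/chainsP => s; rewrite ffunE.
by have [->|/cm//] := eqVneq (c s) 0; rewrite add0r; apply: dm.
Qed.

Hypothesis TC : Tcomplex.
Let tK := tcK TC.

Lemma timsetK : involutive (fun s : {set V} => t @: s).
Proof.
by move=> s /=; rewrite -imset_comp (eq_imset (g := id)) ?imset_id// => x /=.
Qed.

Lemma chain_mapT (c : chain V) s : chain_map t c s = c (t @: s).
Proof.
rewrite ffunE (big_pred1 (t @: s))// => r /=.
have [<-|rs] := eqVneq (t @: r) s.
  by rewrite timsetK eqxx card_imset ?eqxx//; apply: inv_inj.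
by apply/esym/negbTE; apply: contraNneq rs => ->; rewrite timsetK.
Qed.

Lemma chain_mapTK (c : chain V) : chain_map t (chain_map t c) = c.
Proof. by apply/ffunP => s; rewrite !chain_mapT timsetK. Qed.

Lemma chains_T m c : c \in chains K m -> chain_map t c \in chains K m.
Proof.
move=> /chainsP H; apply/chainsP => s; rewrite chain_mapT => /H[sK <-].
by rewrite -{1}(timsetK s) (tc_inv TC sK) card_imset//; apply: inv_inj.
Qed.

Lemma chains_boundary m c :
  c \in chains K m.+1 -> boundary c \in chains K m.
Proof.
move=> /chainsP H; apply/chainsP => s; rewrite ffunE.
case: (s =P set0) => [|/eqP s0]; first by rewrite eqxx.
case: (pickP (fun r : {set V} => [&& s \subset r, #|r| == #|s|.+1 & c r != 0])).
  move=> r /and3P[sr /eqP cr /H[rK e]] _; split; first exact: (tc_face TC rK).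
  by move: e; rewrite cr => -[].
move=> n; rewrite big1 ?eqxx// => r /andP[sr cr].
by have := n r; rewrite sr cr /= => /eqP.
Qed.

Lemma boundaryT m c : c \in chains K m ->
  boundary (chain_map t c) = chain_map t (boundary c).
Proof. by move=> /chains_set0; exact: chain_map_boundary. Qed.

Lemma inv_chainsP m (c : chain V) :
  reflect (c \in chains K m /\ chain_map t c = c) (c \in inv_chains K t m).
Proof. by apply: (iffP setIdP) => -[? /eqP]. Qed.

Lemma inv_cyclesP m (c : chain V) :
  reflect [/\ c \in chains K m, chain_map t c = c & boundary c = 0]
    (c \in inv_cycles K t m).
Proof.
apply: (iffP setIdP) => [[/inv_chainsP[? ?] /eqP]//|[? ? ->]].
by split=> //; apply/inv_chainsP.
Qed.

Lemma inv_chains_double m d :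
  d \in chains K m -> d + chain_map t d \in inv_chains K t m.
Proof.
move=> dm; apply/inv_chainsP; split; first by rewrite chainsD ?chains_T.
by rewrite raddfD /= chain_mapTK addrC.
Qed.

(** By freeness each orbit of simplices has two elements, and the one that comes first in the
    enumeration is kept. *)
Lemma inv_half m c : c \in inv_chains K t m ->
  exists2 d, d \in chains K m & c = d + chain_map t d.
Proof.
move=> /inv_chainsP[/chainsP cK ct].
pose b (s : {set V}) := (enum_rank s < enum_rank (t @: s))%N.
exists [ffun s => if b s then c s else 0].
  by apply/chainsP => s; rewrite ffunE; case: ifP => _; rewrite ?eqxx//; apply: cK.
apply/ffunP => s; rewrite ffunE chain_mapT !ffunE /b timsetK.
have cts : c (t @: s) = c s by rewrite -chain_mapT ct.
rewrite cts; have [cs|/cK[sK _]] := eqVneq (c s) 0.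
  by rewrite cs !if_same addr0.
case: ltngtP => [||/val_inj/enum_rank_inj ts]; rewrite ?add0r ?addr0//.
by have := tc_free TC sK; rewrite -ts eqxx.
Qed.

Lemma cycle_indexD m c d a b : cycle_index K t m c a ->
  cycle_index K t m d b -> cycle_index K t m (c + d) (a + b).
Proof.
elim: m c d => [|m IH] c d /= [e [eK -> ea]] [f [fK -> fb]].
  exists (e + f); split; first exact: chainsD.
    by rewrite raddfD /= addrACA.
  by rewrite -ea -fb -big_split; apply: eq_bigr => s _; rewrite ffunE.
exists (e + f); split; first exact: chainsD.
  by rewrite raddfD /= addrACA.
by rewrite raddfD /=; exact: IH.
Qed.

Definition csum (c : chain V) : 'F_2 := \sum_s c s.

Lemma csum_additive : zmod_morphism csum.
Proof. by move=> c d; rewrite /csum -sumrB; apply: eq_bigr => s _; rewrite !ffunE. Qed.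

HB.instance Definition _ :=
  GRing.isZmodMorphism.Build (chain V) 'F_2 csum csum_additive.

Lemma csum_simp (l : seq V) : uniq l -> l != [::] -> csum (simp l) = 1.
Proof.
move=> ul l0; rewrite /csum (bigD1 [set x in l])//= big1 => [|s sl].
  by rewrite ffunE ul l0 eqxx addr0.
by rewrite ffunE (negPf sl) andbF.
Qed.

Lemma csum_boundary c : c \in chains K 1 -> csum (boundary c) = 0.
Proof.
move=> cK; have c0 := chains_set0 cK.
have := @additive_eq_supp _ _ (csum \o @boundary V) \0 c c0; apply => s cs /=.
have := chainsP _ _ cK s cs => -[_]; rewrite cardE boundary_simp.
have := enum_uniq s; case: (enum s) => [|x [|y [|]]]//= _ _.
by rewrite !big_cons big_nil addr0 raddfD /= !csum_simp// addF2.
Qed.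

Lemma csumT c : csum (chain_map t c) = csum c.
Proof.
rewrite /csum [RHS](reindex_inj (inv_inj timsetK)) /=.
by apply: eq_bigr => s _; rewrite chain_mapT.
Qed.

Lemma half_uniq m b d : b \in chains K m -> d \in chains K m ->
  b + chain_map t b = d + chain_map t d ->
  exists2 f, f \in chains K m & d = f + chain_map t f + b.
Proof.
move=> bK dK e; have : d + b \in inv_chains K t m.
  apply/inv_chainsP; split; first exact: chainsD.
  apply: eqcc; rewrite raddfD /= addrACA [_ + d]addrC [_ + b]addrC.
  by rewrite e addcc.
by move=> /inv_half[f fK E]; exists f; rewrite // -E -addrA addcc addr0.
Qed.

(** Any other half of this chain is f + t f + [boundary e]. Since [boundary e] is closed, one step
    of the index leads to the same situation for f, one degree lower. In degree 0, f and t f have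
    equal counts and the boundary of a 1-chain has an even one. Both the uniqueness of the index and
    its vanishing on invariant boundaries follow. *)
Lemma cycle_index_bnd m e a : e \in chains K m.+1 ->
  cycle_index K t m (boundary e + chain_map t (boundary e)) a -> a = 0.
Proof.
elim: m e => [|m IH] e eK /= [d [dK de da]].
all: case: (half_uniq (chains_boundary eK) dK de) => f fK dE.
  rewrite -da -/(csum d) dE !raddfD /= csumT addF2 add0r.
  by rewrite csum_boundary.
apply: (IH f fK); rewrite dE !raddfD /= in da.
by rewrite boundary_boundary ?(chains_set0 eK)// addr0 (boundaryT fK) in da.
Qed.

Lemma cycle_index_boundary m c a : c \in inv_boundaries K t m ->
  cycle_index K t m c a -> a = 0.
Proof.
move=> /imsetP[e /inv_half[f fK ->] ->]; rewrite raddfD /= (boundaryT fK).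
exact: cycle_index_bnd.
Qed.

Lemma cycle_index_uniq m c a b :
  cycle_index K t m c a -> cycle_index K t m c b -> a = b.
Proof.
move=> ca cb; apply: eqF2; have := cycle_indexD ca cb; rewrite addcc => i0.
apply: (@cycle_index_bnd m 0); first exact: chains0.
by rewrite !raddf0 addr0.
Qed.

Lemma cycle_index_ex m c : c \in inv_cycles K t m ->
  exists a, cycle_index K t m c a.
Proof.
elim: m c => [|m IH] c /inv_cyclesP[cK ct bc].
  have /inv_half[d dK ->] : c \in inv_chains K t 0 by apply/inv_chainsP.
  by exists (csum d), d.
have /inv_half[d dK dE] : c \in inv_chains K t m.+1 by apply/inv_chainsP.
have /IH[a da] : boundary d \in inv_cycles K t m.
  apply/inv_cyclesP; split; first exact: chains_boundary.
    apply: eqcc; rewrite -(boundaryT dK) -raddfD/= addrC -dE//.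
  by rewrite boundary_boundary// (chains_set0 dK).
by exists a, d.
Qed.

Lemma cycle_index_neq0 m c a : cycle_index K t m c a -> a != 0 ->
  exists2 s, s \in K & s != set0.
Proof.
elim: m c => [|m IH] c /= [d [/chainsP dK _ da]]; last exact: IH da.
case: (pickP (fun s => d s != 0)) => [s /dK[sK cs] _|n].
  by exists s => //; rewrite -cards_eq0 cs.
by rewrite -da big1 ?eqxx// => s _; apply/eqP; rewrite -[_ == _]negbK n.
Qed.

End TComplex.

(** * Naturality of the index under equivariant simplicial maps *)

Section Naturality.
Variables (V W : finType) (K : {set {set V}}) (L : {set {set W}}).
Variables (t : V -> V) (u : W -> W) (p : V -> W).

Definition simplicial := forall s, s \in K -> p @: s \in L.
Definition equivariant :=
  forall s x, s \in K -> x \in s -> p (t x) = u (p x).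

Hypotheses (pL : simplicial) (pT : equivariant).

Lemma chains_map m c : c \in chains K m -> chain_map p c \in chains L m.
Proof.
move=> /chainsP H; apply/chainsP => r; rewrite ffunE.
case: (pickP (fun s : {set V} => [&& p @: s == r, #|s| == #|r| & c s != 0])).
  by move=> s /and3P[/eqP <- /eqP <- /H[sK ->]] _; split=> //; exact: pL.
move=> n; rewrite big1 ?eqxx// => s /andP[pr cr].
by have := n s; rewrite pr cr /= => /eqP.
Qed.

Lemma chain_map_equi m c : c \in chains K m ->
  chain_map p (chain_map t c) = chain_map u (chain_map p c).
Proof.
move=> cK; have := @additive_eq_supp _ _ (chain_map p \o chain_map t)
  (chain_map u \o chain_map p) c (chains_set0 cK); apply => s cs /=.
rewrite !chain_map_simp -!map_comp; congr simp; apply/eq_in_map => x.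
by rewrite mem_enum => xs /=; apply: (pT _ xs); case: (chainsP _ _ _ cK s cs).
Qed.

Lemma cycle_index_map m c a :
  cycle_index K t m c a -> cycle_index L u m (chain_map p c) a.
Proof.
elim: m c => [|m IH] c /= [d [dK -> da]]; exists (chain_map p d); split.
- exact: chains_map.
- by rewrite raddfD /= (chain_map_equi dK).
- rewrite -da; have := @additive_eq_supp _ _ (@csum W \o chain_map p)
    (@csum V) d (chains_set0 dK); apply => s /(chainsP _ _ _ dK)[_] /=.
  rewrite chain_map_simp cardE; have := enum_uniq s.
  by case: (enum s) => [|x [|y l]]//= _ _; rewrite !csum_simp.
- exact: chains_map.
- by rewrite raddfD /= (chain_map_equi dK).
- by rewrite chain_map_boundary ?(chains_set0 dK)//; exact: IH.
Qed.

Lemma inv_chains_map m c :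
  c \in inv_chains K t m -> chain_map p c \in inv_chains L u m.
Proof.
move=> /inv_chainsP[cK ct]; apply/inv_chainsP; split; first exact: chains_map.
by rewrite -(chain_map_equi cK) ct.
Qed.

Lemma inv_cycles_map m c :
  c \in inv_cycles K t m -> chain_map p c \in inv_cycles L u m.
Proof.
move=> /inv_cyclesP[cK ct bc]; apply/inv_cyclesP.
have /inv_chains_map/inv_chainsP[pK pt] : c \in inv_chains K t m.
  by apply/inv_chainsP.
by split=> //; rewrite chain_map_boundary ?(chains_set0 cK)// bc raddf0.
Qed.

Lemma inv_boundaries_map m c :
  c \in inv_boundaries K t m -> chain_map p c \in inv_boundaries L u m.
Proof.
move=> /imsetP[d dK ->]; apply/imsetP; exists (chain_map p d).
  exact: inv_chains_map.
case/inv_chainsP: dK => dK _.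
by rewrite chain_map_boundary ?(chains_set0 dK).
Qed.

End Naturality.

(** * Contiguous maps and reduction *)

Lemma chains_sum (V : finType) (K : {set {set V}}) m (I : Type) (r : seq I)
    (P : pred I) (F : I -> chain V) :
  (forall i, P i -> F i \in chains K m) -> \sum_(i <- r | P i) F i \in chains K m.
Proof.
move=> H; elim/big_rec: _ => [|i c Pi cK]; first exact: chains0.
by apply: chainsD => //; exact: H.
Qed.

Lemma simp_chains (V : finType) (K : {set {set V}}) (l : seq V) :
  [set x in l] \in K -> simp l \in chains K (size l).-1.
Proof.
case: l => [|x l] lK; first by rewrite simp_nil chains0.
apply/chainsP => s; rewrite ffunE andTb.
have [ul|] := boolP (uniq _); last by rewrite eqxx.
have [->|] := eqVneq s; last by rewrite eqxx.
by split=> //; rewrite -[RHS](card_uniqP ul); apply: eq_card => y; rewrite inE.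
Qed.

Section OrderedSimplices.
Variables (V : finType) (K : {set {set V}}) (t : V -> V).
Hypothesis TC : Tcomplex K t.

Definition orbit_rank (x : V) : nat := minn (enum_rank x) (enum_rank (t x)).

Lemma orbit_rankT x : orbit_rank (t x) = orbit_rank x.
Proof. by rewrite /orbit_rank (tcK TC) minnC. Qed.

(** Distinct vertices of equal orbit rank are x and t x, and they would span an invariant face. *)
Lemma orbit_rank_inj s : s \in K -> {in s &, injective orbit_rank}.
Proof.
move=> sK x y xs ys e; have [//|xy] := eqVneq x y.
have ty : y = t x.
  move: e xy; rewrite /orbit_rank /minn.
  case: ltnP => _; case: ltnP => _ /val_inj/enum_rank_inj //.
  - by move=> -> ; rewrite eqxx.
  - by move=> ->; rewrite (tcK TC).
  - by move=> /(inv_inj (tcK TC)) ->; rewrite eqxx.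
have : [set x; t x] \in K.
  apply: (tc_face TC sK).
    by apply/subsetP => z; rewrite !inE -ty => /orP[] /eqP ->.
  by apply/set0Pn; exists x; rewrite !inE eqxx.
move=> /(tc_free TC)/eqP[]; apply/setP => z; rewrite imsetU1 imset_set1 (tcK TC).
by rewrite !inE orbC.
Qed.

(* Ordering every simplex by orbits makes the prism of two equivariant maps *)
(* equivariant.                                                             *)
Definition ordl (s : {set V}) : seq V :=
  sort (relpre orbit_rank leq) (enum s).

Lemma ordl_unique s l : s \in K -> uniq l -> l =i s ->
  sorted (relpre orbit_rank leq) l -> ordl s = l.
Proof.
move=> sK ul ls sl.
have pm : perm_eq (ordl s) l.
  rewrite /ordl perm_sort uniq_perm ?enum_uniq// => x.
  by rewrite mem_enum ls.
apply: (inj_in_map (orbit_rank_inj sK)).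
- by apply/allP => x; rewrite (perm_mem pm) ls.
- by apply/allP => x; rewrite ls.
apply: (@sorted_eq _ leq leq_trans anti_leq); rewrite ?sorted_map//.
  by apply: sort_sorted => x y /=; exact: leq_total.
exact: perm_map.
Qed.

Lemma mem_ordl s : ordl s =i s.
Proof. by move=> x; rewrite mem_sort mem_enum. Qed.

Lemma ordl_uniq s : uniq (ordl s).
Proof. by rewrite sort_uniq enum_uniq. Qed.

Lemma ordl_sorted s : sorted (relpre orbit_rank leq) (ordl s).
Proof. by apply: sort_sorted => x y /=; exact: leq_total. Qed.

Lemma size_ordl s : size (ordl s) = #|s|.
Proof. by rewrite size_sort -cardE. Qed.

Lemma set_ordl s : [set x in ordl s] = s.
Proof. by apply/setP => x; rewrite inE mem_ordl. Qed.

Lemma ordlT s : s \in K -> ordl (t @: s) = map t (ordl s).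
Proof.
move=> sK; apply: ordl_unique.
- exact: (tc_inv TC).
- by rewrite map_inj_uniq ?ordl_uniq//; exact: inv_inj (tcK TC).
- move=> x; apply/mapP/imsetP => -[y ys ->];
  by exists y; rewrite ?mem_ordl// in ys *.
- rewrite sorted_map (eq_sorted (e' := relpre orbit_rank leq)) ?ordl_sorted//.
  by move=> x y /=; rewrite !orbit_rankT.
Qed.

Lemma ordl_faces s r : s \in K -> r \in faces (ordl s) -> r != [::] ->
  [set x in r] \in K /\ ordl [set x in r] = r.
Proof.
move=> sK /faces_subseq rs r0.
have rK : [set x in r] \in K.
  apply: (tc_face TC sK).
    by apply/subsetP => x; rewrite inE => /(mem_subseq rs); rewrite mem_ordl.
  case: r r0 {rs} => // x r _; apply/set0Pn; exists x; rewrite inE; exact: mem_head.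
split=> //; apply: ordl_unique => //.
- exact: subseq_uniq (ordl_uniq s).
- by move=> x; rewrite inE.
- by apply: subseq_sorted rs (ordl_sorted s) => x y z /=; exact: leq_trans.
Qed.

Lemma simp_ordl s : simp (ordl s) = simp (enum s).
Proof. by apply: simp_perm; rewrite perm_sort. Qed.

End OrderedSimplices.

Section Contiguity.
Variables (V W : finType) (K : {set {set V}}) (L : {set {set W}}).
Variables (t : V -> V) (u : W -> W) (p q : V -> W).
Hypotheses (TK : Tcomplex K t) (TL : Tcomplex L u).
Hypotheses (pT : equivariant K t u p) (qT : equivariant K t u q).
Hypothesis pqL : forall s, s \in K -> p @: s :|: q @: s \in L.

Let G (s : {set V}) : chain W := \sum_(r <- pr p q (ordl t s)) simp r.

Lemma lin_simp (l : seq V) : uniq l -> l != [::] ->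
  lin G (simp l) = G [set x in l].
Proof.
move=> ul l0; apply/ffunP => A; rewrite ffunE (bigD1 [set x in l])//= big1.
  by rewrite ffunE ul l0 eqxx /= mul1r addr0.
by move=> s sl; rewrite ffunE (negPf sl) andbF mul0r.
Qed.

Lemma prism_simp s : s \in K ->
  boundary (lin G (simp (enum s))) + lin G (boundary (simp (enum s))) =
  chain_map p (simp (enum s)) + chain_map q (simp (enum s)).
Proof.
move=> sK; rewrite -(simp_ordl t).
have s0 : ordl t s != [::].
  rewrite -size_eq0 size_ordl cards_eq0; apply/eqP => s0.
  by have := tc_neq0 TK; rewrite -s0 sK.
rewrite lin_simp ?ordl_uniq// set_ordl boundary_simp !chain_map_simp.
rewrite raddf_sum [X in _ + X](_ : _ =
    \sum_(r <- faces (ordl t s)) \sum_(r' <- pr p q r) simp r'); last first.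
  rewrite raddf_sum; apply: eq_big_seq => r rs /=.
  have [->|r0] := eqVneq r [::]; first by rewrite simp_nil raddf0 big_nil.
  rewrite lin_simp//; last exact: subseq_uniq (faces_subseq rs) (ordl_uniq _ _).
  by rewrite /G; case: (ordl_faces TK sK rs r0) => _ ->.
apply/ffunP => A; rewrite !ffunE !sum_ffunE.
have := pr_bd (fun r => simp r A) p q (ordl t s).
rewrite ev_bd ev_prism /ev !ffunE => <-; congr (_ + _).
  by apply: eq_bigr => r _; rewrite /= boundary_simp sum_ffunE.
by apply: eq_bigr => r _; rewrite sum_ffunE.
Qed.

Lemma prism_chains m c : c \in chains K m -> lin G c \in chains L m.+1.
Proof.
move=> cK; rewrite (chainE (chains_set0 cK)) raddf_sum /=.
apply: chains_sum => s /(chainsP _ _ _ cK)[sK cs].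
have s0 : enum s != [::] by rewrite -size_eq0 -cardE cs.
rewrite lin_simp ?enum_uniq// (_ : [set x in enum s] = s); last first.
  by apply/setP => x; rewrite inE mem_enum.
rewrite /G big_seq; apply: chains_sum => r rs.
have := pr_size rs; rewrite size_ordl cs => sr.
have -> : m.+1 = (size r).-1 by rewrite sr.
apply: simp_chains; apply: (tc_face TL (pqL sK)); last first.
  case: r rs sr => // x r _ _; apply/set0Pn; exists x; rewrite inE; exact: mem_head.
apply/subsetP => z; rewrite !inE => zr.
have [x] := pr_mem rs zr; rewrite mem_ordl => xs [] ->.
  by rewrite (imset_f p xs).
by rewrite (imset_f q xs) orbT.
Qed.

Lemma prism_equi m c : c \in chains K m ->
  chain_map u (lin G c) = lin G (chain_map t c).
Proof.
move=> cK; have := @additive_eq_supp _ _ (chain_map u \o lin G)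
  (lin G \o chain_map t) c (chains_set0 cK); apply => s.
move=> /(chainsP _ _ _ cK)[sK cs] /=.
have s0 : ordl t s != [::] by rewrite -size_eq0 size_ordl cs.
have s1 : map t (ordl t s) != [::] by case: (ordl _ _) s0.
have us : uniq (map t (ordl t s)).
  by rewrite map_inj_uniq ?ordl_uniq//; exact: inv_inj (tcK TK).
rewrite -(simp_ordl t) chain_map_simp !lin_simp ?ordl_uniq// set_ordl.
rewrite -(ordlT TK sK) set_ordl /G (ordlT TK sK) raddf_sum.
rewrite -(@pr_equi _ _ _ _ t u p q) ?big_map.
- by apply: eq_bigr => r _; rewrite /= chain_map_simp.
- by move=> y; rewrite mem_ordl => ys; rewrite -(pT sK).
- by move=> y; rewrite mem_ordl => ys; rewrite -(qT sK).
Qed.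

(** The prism over ordered simplices commutes with the involutions, so it sends the invariant cycle
    to an invariant chain whose boundary is the sum of the two images. *)
Lemma contiguous_homologous m c : c \in inv_cycles K t m ->
  chain_map p c + chain_map q c \in inv_boundaries L u m.
Proof.
move=> /inv_cyclesP[cK ct bc]; apply/imsetP; exists (lin G c).
  by apply/inv_chainsP; rewrite (prism_chains cK) (prism_equi cK) ct.
have := @additive_eq_supp _ _
  ((@boundary W \o lin G) \+ (lin G \o @boundary V)) (chain_map p \+ chain_map q)
  c (chains_set0 cK).
rewrite /= bc raddf0 addr0 => -> // s /(chainsP _ _ _ cK)[sK cs].
exact: prism_simp.
Qed.

End Contiguity.

(** * Lowering the dimension while keeping the index *)

Section Reduction.
Variables (V : finType) (K : {set {set V}}) (t : V -> V).
Hypothesis TC : Tcomplex K t.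

Lemma Tcomplex_sub (P : pred V) : (forall x, P (t x) = P x) ->
  Tcomplex [set s in K | [forall x in s, P x]] t.
Proof.
move=> Pt; split; first exact: tcK TC.
- move=> s; rewrite !inE => /andP[sK /forall_inP sP]; rewrite (tc_inv TC sK).
  by apply/forall_inP => _ /imsetP[x xs ->]; rewrite Pt sP.
- move=> s r; rewrite !inE => /andP[sK /forall_inP sP] rs r0.
  rewrite (tc_face TC sK rs r0); apply/forall_inP => x xr.
  by apply: sP; exact: (subsetP rs).
- by move=> s; rewrite inE => /andP[/(tc_free TC)].
- by rewrite inE (negPf (tc_neq0 TC)).
Qed.

(* Yang's argument: c = d + T d for d = P + e', where P is the part of c that *)
(* meets pos and e' is half of the part that meets neither pos nor neg; the   *)
(* invariant cycle boundary d then avoids pos, hence neg.                     *)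
Lemma index_reduction (pos : pred V) m c a :
  (forall s, s \in K -> forall x y, x \in s -> y \in s -> pos x -> ~~ pos (t y)) ->
  c \in inv_cycles K t m.+1 -> cycle_index K t m.+1 c a ->
  let K0 := [set s in K | [forall x in s, ~~ pos x && ~~ pos (t x)]] in
  exists2 z, z \in inv_cycles K0 t m & cycle_index K0 t m z a.
Proof.
move=> exc cZ ca K0.
have TC0 : Tcomplex K0 t.
  by apply: Tcomplex_sub => x; rewrite (tcK TC) andbC.
have /inv_cyclesP[cK ct bc] := cZ.
have cts (s : {set V}) : c (t @: s) = c s by rewrite -(chain_mapT TC) ct.
pose hp (s : {set V}) := [exists x in s, pos x].
have hpT (s : {set V}) : hp (t @: s) = [exists x in s, pos (t x)].
  apply/exists_inP/exists_inP => [[_ /imsetP[x xs ->]]|[x xs]] px.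
    by exists x.
    by exists (t x) => //; exact: imset_f.
have K0E (s : {set V}) : (s \in K0) = [&& s \in K, ~~ hp s & ~~ hp (t @: s)].
  rewrite inE hpT !negb_exists_in; congr (_ && _).
  apply/forall_inP/andP => [H|[/forall_inP H1 /forall_inP H2] x xs].
    by split; apply/forall_inP => x xs; case/andP: (H x xs).
  by rewrite H1// H2.
have hpX (s : {set V}) : s \in K -> hp s -> ~~ hp (t @: s).
  move=> sK /exists_inP[x xs px]; rewrite hpT negb_exists_in.
  by apply/forall_inP => y ys; exact: (exc s sK x y).
pose P : chain V := [ffun s => if hp s then c s else 0].
pose Q : chain V := [ffun s => if s \in K0 then c s else 0].
have PK : P \in chains K m.+1.
  by apply/chainsP => s; rewrite ffunE; case: ifP; rewrite ?eqxx// => _ /(chainsP _ _ _ cK).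
have cE : c = P + chain_map t P + Q.
  apply/ffunP => s; rewrite ffunE ffunE (chain_mapT TC) !ffunE cts K0E.
  have [->|/(chainsP _ _ _ cK)[sK _]] := eqVneq (c s) 0.
    by rewrite !if_same !addr0.
  rewrite sK /=; have := hpX s sK; case: (hp s) => [/(_ isT)/negPf ->|_].
    by rewrite /= !addr0.
  by case: (hp (t @: s)) => /=; rewrite !(add0r, addr0).
have /(inv_half TC0)[e eK Qe] : Q \in inv_chains K0 t m.+1.
  apply/inv_chainsP; split.
    apply/chainsP => s; rewrite ffunE; case: ifP; rewrite ?eqxx// => _.
    by case/(chainsP _ _ _ cK).
  apply/ffunP => s; rewrite (chain_mapT TC) !ffunE cts.
  suff -> : (t @: s \in K0) = (s \in K0) by [].
  apply/idP/idP => [/(tc_inv TC0)|/(tc_inv TC0)//].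
  by rewrite (timsetK TC).
have K0K : simplicial K0 K (@id V).
  by move=> s; rewrite imset_id inE => /andP[].
have eK1 : e \in chains K m.+1.
  apply/chainsP => s /(chainsP _ _ _ eK)[]; rewrite inE => /andP[sK _] ->.
  by [].
pose d := P + e; have dK : d \in chains K m.+1 by exact: chainsD.
have cd : c = d + chain_map t d.
  by rewrite cE Qe raddfD /= addrACA.
set z := boundary d.
have zK : z \in inv_cycles K t m.
  apply/inv_cyclesP; split; first exact: (chains_boundary TC).
    apply: eqcc; rewrite -(boundaryT t dK) -raddfD/= addrC -cd//.
  by rewrite boundary_boundary// (chains_set0 dK).
(* Simplices of [P] meet [pos], hence avoid its image under [t], and so do their faces; simplices of
   [e] avoid both sets. As [z] is invariant, it then avoids [pos] as well. *)
have zneg (s : {set V}) : hp (t @: s) -> z s = 0.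
  move=> hts; rewrite /z raddfD /= ffunE.
  have -> : boundary e s = 0.
    apply/eqP/negPn/negP => /(chainsP _ _ _ (chains_boundary TC0 eK))[].
    by rewrite K0E hts !andbF.
  rewrite addr0 ffunE; case: eqP => // _; apply: big1 => r /andP[sr _].
  rewrite ffunE; case: ifP => // hr.
  apply/eqP/negPn/negP => /(chainsP _ _ _ cK)[rK _].
  have /negP[] := hpX r rK hr; move: hts => /exists_inP[x xs px].
  by apply/exists_inP; exists x => //; apply: (subsetP (imsetS _ sr)).
have /inv_cyclesP[zK' zt bz] := zK.
have zK0 : z \in inv_cycles K0 t m.
  apply/inv_cyclesP; split=> //; apply/chainsP => s zs.
  have [sK ->] := chainsP _ _ _ zK' s zs; split=> //.
  rewrite K0E sK /=; apply/andP; split; apply: contraNN zs => hs; apply/eqP.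
    by rewrite -zt (chain_mapT TC) zneg// (timsetK TC).
  exact: zneg.
exists z => //.
have [b zb] := cycle_index_ex TC0 zK0.
have idK0 : equivariant K0 t t (@id V) by [].
have := cycle_index_map K0K idK0 zb.
rewrite chain_map_id ?(chains_set0 zK')// => zb'.
(* The index of [z] inside [K0] is carried to [K] by the inclusion, where [d] shows that it is the
   index of [c]. *)
suff -> : a = b by [].
by apply: (cycle_index_uniq TC ca); exists d.
Qed.

End Reduction.

From mathcomp Require Import all_classical all_reals all_analysis.

Import numFieldNormedType.Exports.

Local Open Scope classical_set_scope.

(** * Cech homology of nerves *)

Section HomologyClasses.
Variables (V : finType) (K : {set {set V}}) (t : V -> V).
Hypothesis TC : Tcomplex K t.

Lemma inv_boundaries0 m : 0 \in inv_boundaries K t m.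
Proof.
apply/imsetP; exists 0; rewrite ?raddf0//.
by apply/inv_chainsP; rewrite raddf0; split => //; exact: chains0.
Qed.

Lemma inv_boundariesD m c d : c \in inv_boundaries K t m ->
  d \in inv_boundaries K t m -> c + d \in inv_boundaries K t m.
Proof.
move=> /imsetP[e /inv_chainsP[eK et] ->] /imsetP[f /inv_chainsP[fK ft] ->].
apply/imsetP; exists (e + f); last by rewrite raddfD.
by apply/inv_chainsP; rewrite raddfD /= et ft; split => //; exact: chainsD.
Qed.

Lemma hclassP m c d :
  reflect (d + c \in inv_boundaries K t m) (d \in hclass K t m c).
Proof.
apply: (iffP imsetP) => [[b bB ->]|dc].
  by rewrite addrAC addcc add0r.
by exists (d + c) => //; rewrite addrCA addcc addr0.
Qed.

Lemma mem_hclass m c : c \in hclass K t m c.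
Proof. by apply/hclassP; rewrite addcc inv_boundaries0. Qed.

Lemma hclass_eq m c d : c + d \in inv_boundaries K t m ->
  hclass K t m c = hclass K t m d.
Proof.
move=> cd; apply/setP => e; apply/hclassP/hclassP => H.
  by have := inv_boundariesD H cd; rewrite addrA -[e + c + c]addrA addcc addr0.
have := inv_boundariesD H cd.
by rewrite [c + d]addrC addrA -[e + d + d]addrA addcc addr0.
Qed.

End HomologyClasses.

(** * Nerves, refinements and the inverse limit *)

Section Cech.
Variables (X : topologicalType) (T : X -> X).
Hypothesis TK : involutive T.
Implicit Types (u v w : Tcover T).

Lemma Timset (A : set X) : T @` (T @` A) = A.
Proof.
rewrite eqEsubset; split => [_ [_ [x Ax <-] <-]|x Ax]; first by rewrite TK.
by exists (T x); [exists x|rewrite TK].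
Qed.

Lemma vertexTK u : involutive (@vertexT X T u).
Proof. by move=> A; apply: val_inj; rewrite /= Timset. Qed.

Lemma nerveP u (s : {set vertex u}) :
  reflect (s != finset.set0 /\ exists x, forall A : vertex u, A \in s -> (\val A) x)
    (s \in nerve u).
Proof.
by apply: (iffP setIdP) => -[s0]; [move/asboolP|move=> /asboolP].
Qed.

Lemma vertexT_neq u (A : vertex u) : vertexT A != A.
Proof.
apply/eqP => /(congr1 val) /= TA.
have := member_free (valP A); rewrite TA setIid => A0.
by case: (member_neq0 (valP A)) => x; rewrite A0.
Qed.

Lemma nerve_Tcomplex u : Tcomplex (nerve u) (@vertexT X T u).
Proof.
split.
- exact: vertexTK.
- move=> s /nerveP[s0 [x xs]]; apply/nerveP; split; first by rewrite imset_eq0.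
  by exists (T x) => _ /imsetP[A As ->] /=; exists x => //; exact: xs.
- move=> s r /nerveP[s0 [x xs]] /fintype.subsetP rs r0; apply/nerveP; split=> //.
  by exists x => A /rs; exact: xs.
- move=> s /nerveP[/set0Pn[A As] [x xs]]; apply/eqP => ts.
  have TAs : vertexT A \in s by rewrite -ts imset_f.
  have : (val A `&` T @` val A) x by split; [exact: xs|exact: (xs _ TAs)].
  by rewrite (member_free (valP A)).
- by apply/negP => /nerveP[]; rewrite eqxx.
Qed.

Definition refines v u := forall A : vertex v, exists B : vertex u, val A `<=` val B.

(** An arbitrary choice is made on one member of each orbit and extended by equivariance; no member
    of a cover is its own image. *)
Lemma projection_ex v u : refines v u -> exists p : vertex v -> vertex u, is_projection p.
Proof.
move=> /choice[q qP].
pose b (A : vertex v) := (enum_rank A < enum_rank (vertexT A))%N.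
exists (fun A => if b A then q A else vertexT (q (vertexT A))); split=> A.
  case: ifP => _; first exact: qP.
  rewrite -[X in X `<=` _]Timset /=; apply: image_subset.
  exact: (qP (vertexT A)).
rewrite /b vertexTK; case: ltngtP => [||/val_inj/enum_rank_inj e].
- by rewrite vertexTK.
- by [].
- by have := vertexT_neq A; rewrite e eqxx.
Qed.

Section Projections.
Variables (u v : Tcover T) (p : vertex v -> vertex u).
Hypothesis pP : is_projection p.

Lemma projection_simplicial : simplicial (nerve v) (nerve u) p.
Proof.
move=> s /nerveP[s0 [x xs]]; apply/nerveP; split; first by rewrite imset_eq0.
by exists x => _ /imsetP[A As ->]; apply: pP.1; exact: xs.
Qed.

Lemma projection_equivariant :
  equivariant (nerve v) (@vertexT X T v) (@vertexT X T u) p.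
Proof. by move=> s x _ _; exact: pP.2. Qed.

Lemma projection_contiguous (q : vertex v -> vertex u) : is_projection q ->
  forall s, s \in nerve v -> p @: s :|: q @: s \in nerve u.
Proof.
move=> qP s /nerveP[/set0Pn[A0 A0s] [x xs]]; apply/nerveP; split.
  by apply/set0Pn; exists (p A0); rewrite finset.in_setU imset_f.
exists x => B; rewrite finset.in_setU => /orP[] /imsetP[A As ->].
  by apply: pP.1; exact: xs.
by apply: qP.1; exact: xs.
Qed.

Lemma induced_hclass m c :
  induced_map m p (hclass (nerve v) (@vertexT X T v) m c) =
  hclass (nerve u) (@vertexT X T u) m (chain_map p c).
Proof.
have ps := projection_simplicial; have pe := projection_equivariant.
apply/setP => d; apply/imset2P/hclassP => [[e b /hclassP ec bB ->]|dB].
  rewrite addrAC -raddfD /=; apply: inv_boundariesD => //.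
  exact: inv_boundaries_map ec.
exists c (d + chain_map p c) => //; first exact: mem_hclass.
by rewrite addrCA addcc addr0.
Qed.

End Projections.

Lemma refines_trans w v u : refines w v -> refines v u -> refines w u.
Proof.
move=> wv vu A; have [B AB] := wv A; have [C BC] := vu B.
by exists C; exact: subset_trans BC.
Qed.

Lemma projection_comp w v u (p : vertex v -> vertex u) (q : vertex w -> vertex v) :
  is_projection p -> is_projection q -> is_projection (p \o q).
Proof.
move=> [p1 p2] [q1 q2]; split=> A /=; first exact: subset_trans (q1 _) (p1 _).
by rewrite q2 p2.
Qed.

Lemma common_refinement u v : exists w, refines w u /\ refines w v.
Proof.
pose nonempty (C : set X) := `[< C !=set0 >].
pose M := [fset C in [fset setI A B | A in members u, B in members v] |
  nonempty C]%fset.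
have MP C : reflect (C !=set0 /\ exists A B, [/\ A \in members u,
    B \in members v & C = A `&` B]) (C \in M).
  rewrite !inE /=; apply: (iffP andP).
    move=> [/imfset2P[A Au [B Bv ->]] /asboolP C0]; split=> //.
    by exists A, B.
  move=> [C0 [A [B [Au Bv e]]]]; split; last exact/asboolP.
  by apply/imfset2P; exists A => //; exists B.
have TI (A B : set X) : T @` (A `&` B) = T @` A `&` T @` B.
  rewrite eqEsubset; split => [_ [x [Ax Bx] <-]|x [[y Ay <-] [z Bz]]].
    by split; exists x.
  by move=> /(inv_inj TK) zy; exists y => //; split=> //; rewrite -zy.
have Mopen A : A \in M -> open A.
  by move=> /MP[_ [B [C [Bu Cv ->]]]]; apply: openI; [exact: (member_open Bu)|exact: (member_open Cv)].
have Mneq0 A : A \in M -> A !=set0 by move=> /MP[].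
have Mcover x : exists2 A, A \in M & A x.
  have [A Au Ax] := members_cover u x; have [B Bv Bx] := members_cover v x.
  exists (A `&` B) => //; apply/MP; split; first by exists x.
  by exists A, B.
have Minv A : A \in M -> T @` A \in M.
  move=> /MP[[x Ax] [B [C [Bu Cv e]]]]; apply/MP; split.
    by exists (T x); exists x.
  by exists (T @` B), (T @` C); rewrite !members_inv// e TI.
have Mfree A : A \in M -> A `&` T @` A = set0.
  move=> /MP[_ [B [C [Bu Cv ->]]]]; rewrite TI setIACA.
  by rewrite (member_free Bu) set0I.
exists (TCover Mopen Mneq0 Mcover Minv Mfree); split=> -[A AM] /=.
all: have /MP[_ [B [C [Bu Cv ->]]]] := AM.
  by exists [` Bu]%fset; exact: subIsetl.
by exists [` Cv]%fset; exact: subIsetr.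
Qed.

(** Otherwise the complements of the finitely many fibres all lie in the ultrafilter, and their
    intersection is empty. *)
Lemma ultra_finite (I : Type) (G : set_system I) (E : finType) (f : I -> E) :
  UltraFilter G -> exists e, G [set i | f i = e].
Proof.
move=> UG; apply: contrapT => nG.
have : \forall i \near G, forall e : E, f i <> e.
  apply: filter_forall => e; case: (in_ultra_setVsetC [set i | f i = e] UG) => //.
  by move=> Ge; exfalso; apply: nG; exists e.
by move=> /filter_ex[i /(_ (f i))].
Qed.

(** The cycles chosen on different covers need not be compatible. The component at [u] is therefore
    the ultralimit, over finer and finer [w], of the class at [u] of the cycle chosen on [w]; it
    exists because each nerve has finitely many chains. *)
Lemma index_nontrivial_of m (u0 : Tcover T) :
  (forall u, exists2 c, c \in inv_cycles (nerve u) (@vertexT X T u) m &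
     cycle_index (nerve u) (@vertexT X T u) m c 1) ->
  index_nontrivial T m.
Proof.
move=> H.
pose cyc u := sval (cid2 (H u)).
have cycZ u : cyc u \in inv_cycles (nerve u) (@vertexT X T u) m.
  by rewrite /cyc; case: (cid2 _).
have cyc1 u : cycle_index (nerve u) (@vertexT X T u) m (cyc u) 1.
  by rewrite /cyc; case: (cid2 _).
(* By contiguity the class does not depend on the projection. The default empty set is harmless: the
   refinements of [u] form a member of the ultrafilter [G] below. *)
pose cls u w : {set chain (vertex u)} :=
  match pselect (exists p : vertex w -> vertex u, is_projection p) with
  | left e => hclass (nerve u) (@vertexT X T u) m (chain_map (sval (cid e)) (cyc w))
  | right _ => finset.set0
  end.
have clsE u w (p : vertex w -> vertex u) : is_projection p ->
    cls u w = hclass (nerve u) (@vertexT X T u) m (chain_map p (cyc w)).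
  move=> pP; rewrite /cls; case: pselect => [e|[]]; last by exists p.
  apply: hclass_eq.
  apply: (contiguous_homologous (nerve_Tcomplex w) (nerve_Tcomplex u)) => //.
  - exact: projection_equivariant (svalP (cid e)).
  - exact: projection_equivariant.
  - by move=> s; apply: projection_contiguous => //; exact: (svalP (cid e)).
pose F : set_system (Tcover T) := [set S | exists u, forall w, refines w u -> S w].
have FP : ProperFilter F.
  apply: Build_ProperFilter_ex.
    by move=> S [u uS]; exists u; apply: uS => A; exists A.
  split.
  - by exists u0.
  - move=> P Q [u uP] [v vQ]; have [w [wu wv]] := common_refinement u v.
    by exists w => z zw; split; [apply: uP|apply: vQ]; exact: refines_trans zw _.
  - by move=> P Q PQ [u uP]; exists u => w /uP; exact: PQ.
have [G [UG FG]] := ultraFilterLemma FP.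
have GI P Q : G P -> G Q -> G (P `&` Q) by move=> GP GQ; exact: filterI.
have Gref u : G [set w | refines w u] by apply: FG; exists u.
pose h u := sval (cid (ultra_finite (cls u) UG)).
have hP u : G [set w | cls u w = h u] := svalP (cid (ultra_finite (cls u) UG)).
have hE u : exists w (p : vertex w -> vertex u),
    [/\ is_projection p, h u = hclass (nerve u) (@vertexT X T u) m (chain_map p (cyc w))
      & cls u w = h u].
  have /filter_ex[w [/= ch /projection_ex[p pP]]] := GI _ _ (hP u) (Gref u).
  by exists w, p; rewrite -ch (clsE _ _ _ pP).
exists h.
  split=> [u|u v p pP].
    have [w [p [pP -> _]]] := hE u; apply/imsetP.
    exists (chain_map p (cyc w)) => //; apply: inv_cycles_map (cycZ w).
      exact: projection_simplicial.
    exact: projection_equivariant.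
  (* A single cover [w] refining [v] at which both limits are attained; there compatibility is
     functoriality. *)
  have /filter_ex[w /= [[cu cv] /projection_ex[q qP]]] :=
    GI _ _ (GI _ _ (hP u) (hP v)) (Gref v).
  rewrite -cu -cv (clsE _ _ _ qP) (clsE _ _ _ (projection_comp pP qP)).
  rewrite (induced_hclass pP) chain_map_comp//.
  by case/inv_cyclesP: (cycZ w) => /chains_set0.
exists 1; last by [].
have [w [p [pP hu _]]] := hE u0; exists u0; exists (chain_map p (cyc w)).
  by rewrite hu mem_hclass.
apply: cycle_index_map (cyc1 w); first exact: projection_simplicial.
exact: projection_equivariant.
Qed.

(** A class on a common refinement maps to zero in the nerve of [u0], which has no simplices with m
    + 1 vertices when m is this large; by naturality its index is zero. *)
Lemma index_nontrivial_bound m (u0 : Tcover T) :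
  index_nontrivial T m -> (m < #|vertex u0|)%N.
Proof.
move=> [h [hH hC] [a [u [c cu ca]] a0]]; rewrite ltnNge; apply/negP => mu.
have [w [/projection_ex[p pP] /projection_ex[q qP]]] := common_refinement u u0.
have /imsetP[d dZ hw] := hH w.
move: cu; rewrite -(hC _ _ _ pP) hw (induced_hclass pP) => /hclassP cd.
have [b db] := cycle_index_ex (nerve_Tcomplex w) dZ.
have pdb := cycle_index_map (projection_simplicial pP) (projection_equivariant pP) db.
have := cycle_index_boundary (nerve_Tcomplex u) cd (cycle_indexD ca pdb).
move=> /eqF2 ab; have /inv_cyclesP[dK _ _] := dZ.
have qdb := cycle_index_map (projection_simplicial qP) (projection_equivariant qP) db.
have q0 : chain_map q d = 0.
  apply/ffunP => s; rewrite [RHS]ffunE; apply/eqP/negPn/negP.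
  move=> /(chainsP _ _ _ (chains_map (projection_simplicial qP) dK))[_ sm].
  by have := max_card (mem s); rewrite sm ltnNge mu.
have := cycle_index_boundary (nerve_Tcomplex u0) _ qdb.
rewrite q0 inv_boundaries0 -ab => /(_ isT) a0'.
by rewrite a0' eqxx in a0.
Qed.

End Cech.

(** * Spaces with odd coordinates *)

(** The common form of the compactness arguments below: local constants that may be shrunk give one
    global constant. *)
Lemma near_covering_right (R : realType) (X : topologicalType) (A : set X)
    (P : R -> X -> Prop) : compact A ->
  (forall x, A x -> exists2 e, 0 < e & \forall y \near x, forall d, 0 < d -> d < e -> P d y) ->
  exists2 e, 0 < e & forall x, A x -> P e x.
Proof.
move=> /compact_near_coveringP/(_ R (0^'+) P) H AP.
have : \forall e \near 0^'+, A `<=` P e.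
  apply: H => x /AP[e e0 xe].
  exists ([set y | forall d, 0 < d -> d < e -> P d y], [set d : R | 0 < d < e]).
    split=> //=; near=> d; apply/andP; split.
      by near: d; exact: nbhs_right_gt.
    by near: d; exact: nbhs_right_lt.
  by move=> [y d] /= [yP /andP[d0 de]]; exact: yP.
move=> /(@filterI _ _ _ _ _ (nbhs_right_gt 0)) /filter_ex[e [/= e0 eP]].
by exists e.
Unshelve. all: by end_near. Qed.

Section Coordinates.
Variables (R : realType) (X : topologicalType) (T : X -> X).
Variables (J : finType) (o : J -> X -> R).
Hypotheses (X_compact : compact [set: X]) (o_cont : forall j, continuous (o j)).
Hypotheses (o_odd : forall j x, o j (T x) = - o j x).
Hypotheses (o_sep : forall x y, (forall j, o j x = o j y) -> x = y).
Hypotheses (o_neq0 : forall x, exists j, o j x != 0).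

Definition close (e : R) (x y : X) : bool := [forall j, `|o j x - o j y| < e].

Lemma closeP e x y : reflect (forall j, `|o j x - o j y| < e) (close e x y).
Proof. exact: forallP. Qed.

Lemma close_sym e x y : close e x y = close e y x.
Proof. by apply: eq_forallb => j; rewrite distrC. Qed.

Lemma close_trans d e x y z : close d x y -> close e y z -> close (d + e) x z.
Proof.
move=> /closeP xy /closeP yz; apply/closeP => j.
rewrite (le_lt_trans (ler_distD (o j y) _ _))//.
by have := xy j; have := yz j; lra.
Qed.

Lemma close_le d e x y : d <= e -> close d x y -> close e x y.
Proof. by move=> de /closeP xy; apply/closeP => j; exact: lt_le_trans (xy j) _. Qed.

Lemma closeT e x y : close e (T x) (T y) = close e x y.
Proof. by apply: eq_forallb => j; rewrite !o_odd -opprD normrN. Qed.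

Lemma T_invol : involutive T.
Proof. by move=> x; apply: o_sep => j; rewrite !o_odd opprK. Qed.

Lemma T_neq x : T x <> x.
Proof.
move=> Tx; have [j] := o_neq0 x; have := o_odd j x; rewrite Tx => oj.
by move/eqP; apply; lra.
Qed.

Lemma near_close e x : 0 < e -> \forall y \near x, close e x y.
Proof.
move=> e0; have : \forall y \near x, forall j, `|o j x - o j y| < e.
  apply: filter_forall => j; have /cvgrPdist_lt H := @o_cont j x; exact: H.
by apply: filterS => y H; apply/closeP.
Qed.

(** A continuous injection of a compact space into a Hausdorff one is an embedding: near each point
    other than x some coordinate stays away from its value at x, and compactness makes the distance
    uniform. *)
Lemma nbhs_close x A : nbhs x A -> exists2 e, 0 < e & forall y, close e x y -> A y.
Proof.
move=> xA; have [] := @near_covering_right R X setT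
  (fun e y => close e x y -> A y) X_compact.
  move=> y _; have [<-|xy] := pselect (x = y).
    by exists 1 => //; apply: filterS xA => z Az d _ _ _.
  have [j oj] : exists j, o j x <> o j y.
    by apply: contrapT => H; apply: xy; apply: o_sep => j; apply: contrapT => ?;
      apply: H; exists j.
  have c0 : 0 < `|o j x - o j y| by rewrite normr_gt0 subr_eq0; apply/eqP.
  exists (`|o j x - o j y| / 2); first by rewrite divr_gt0.
  apply: filterS (@near_close (`|o j x - o j y| / 2) y _); last by rewrite divr_gt0.
  move=> z /closeP/(_ j) yz d _ de /closeP/(_ j) xz; exfalso.
  by have := ler_distD (o j z) (o j x) (o j y); rewrite (distrC (o j z)); lra.
by move=> e e0 H; exists e => // y; exact: H.
Qed.

Lemma coord_hausdorff : hausdorff_space X.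
Proof.
move=> x y xy; apply: o_sep => j; apply: contrapT => oj.
have c0 : 0 < `|o j x - o j y| by rewrite normr_gt0 subr_eq0; apply/eqP.
have h0 : 0 < `|o j x - o j y| / 2 by rewrite divr_gt0.
have [z [/closeP/(_ j) xz /closeP/(_ j) yz]] := xy _ _ (near_close x h0) (near_close y h0).
by have := ler_distD (o j z) (o j x) (o j y); rewrite (distrC (o j z)); lra.
Qed.

Lemma T_continuous : continuous T.
Proof.
move=> x A /= /nbhs_close[e e0 H]; rewrite nbhs_filterE.
by apply: filterS (near_close x e0) => y xy; apply: H; rewrite closeT.
Qed.

(** Near x some coordinate is bounded away from zero, and T changes its sign. Below this scale the
    complexes of small simplices are free. *)
Lemma coord_gap : exists2 c, 0 < c & forall x, ~~ close c x (T x).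
Proof.
have [] := @near_covering_right R X setT (fun c x => ~~ close c x (T x)) X_compact.
  move=> x _; have [j oj] := o_neq0 x; rewrite -normr_gt0 in oj.
  exists `|o j x| => //.
  apply: filterS (@near_close (`|o j x| / 2) x _); last by rewrite divr_gt0.
  move=> y /closeP/(_ j) xy d d0 de; apply/negP => /closeP/(_ j).
  rewrite o_odd opprK -mulr2n normrMn mulr2n => yT.
  by have := ler_normD (o j x - o j y) (o j y); rewrite subrK; lra.
by move=> c c0 H; exists c => // x; exact: H.
Qed.

Lemma unif_continuous (h : X -> R) d : continuous h -> 0 < d ->
  exists2 e, 0 < e & forall x y, close e x y -> `|h x - h y| < d.
Proof.
move=> hc d0.
have [] := @near_covering_right R X setT
  (fun e x => forall y, close e x y -> `|h x - h y| < d) X_compact.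
  move=> x _; have d2 : 0 < d / 2 by rewrite divr_gt0.
  have /cvgrPdist_lt/(_ _ d2)/nbhs_close[e e0 H] := @hc x.
  exists (e / 2); first by rewrite divr_gt0.
  apply: filterS (@near_close (e / 2) x _); last by rewrite divr_gt0.
  move=> y xy r r0 re z yz.
  have /H xz : close e x z.
    by apply: close_le (close_trans xy yz); lra.
  have /H xy' : close e x y by apply: close_le xy; lra.
  by have := ler_distD (h x) (h y) (h z); rewrite (distrC (h y) (h x)); lra.
by move=> e e0 H; exists e => // x y; exact: H.
Qed.

Section SmallSimplices.
Variables (V : {fset X}) (VT : forall x, x \in V -> T x \in V) (e : R).
Hypothesis e_gap : forall x, ~~ close e x (T x).

Definition fsetT (x : V) : V := [` VT (valP x)]%fset.

(** The Vietoris-Rips complex of scale [e] on [V]. *)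
Definition small_sets : {set {set V}} :=
  [set s : {set V} | (s != finset.set0) &&
    [forall x in s, forall y in s, close e (val x) (val y)]]%SET.

Lemma small_setsP (s : {set V}) :
  reflect (s != finset.set0 /\
           forall x y, x \in s -> y \in s -> close e (val x) (val y))
    (s \in small_sets).
Proof.
apply: (iffP setIdP) => -[s0 H]; split => //.
  by move=> x y xs ys; exact: (forall_inP (forall_inP H x xs) y ys).
by apply/forall_inP => x xs; apply/forall_inP => y ys; exact: H.
Qed.

Lemma small_Tcomplex : Tcomplex small_sets fsetT.
Proof.
split.
- by move=> x; apply: val_inj; rewrite /= T_invol.
- move=> s /small_setsP[s0 H]; apply/small_setsP; split.
    by rewrite imset_eq0.
  by move=> _ _ /imsetP[x xs ->] /imsetP[y ys ->]; rewrite closeT; exact: H.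
- move=> s r /small_setsP[s0 H] /fintype.subsetP rs r0; apply/small_setsP.
  by split=> // x y /rs xs /rs ys; exact: H.
- move=> s /small_setsP[/set0Pn[x xs] H]; apply/eqP => ts.
  have txs : fsetT x \in s by rewrite -ts imset_f.
  by have /negP := e_gap (val x); apply; exact: (H _ _ xs txs).
- by apply/negP => /small_setsP[]; rewrite eqxx.
Qed.

End SmallSimplices.

(* The doubles E i + T (E i) are then fine invariant cycles of index one. *)
Definition ladder (N : nat) (e : R) := exists E : nat -> seq (seq X),
  [/\ forall i s, (i <= N)%N -> s \in E i ->
        size s = i.+1 /\ {in s &, forall x y, close e x y},
      forall i, (i < N)%N -> bd (E i.+1) === E i ++ mp T (E i)
    & exists x, E 0%N = [:: [:: x]]].

End Coordinates.

(** * Zero sets of odd maps *)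

(** One application of [index_reduction] for each function [g i]. A simplex with a vertex where
    [g i] is at least [d] has [g i] positive throughout, since the oscillation is below [d]; this is
    the exclusion required there. *)
Lemma iterated_reduction (R : realType) (V : finType) (t : V -> V) (I : eqType)
    (g : I -> V -> R) (d : R) (l : seq I) (K : {set {set V}}) N c :
  0 < d -> Tcomplex K t -> (forall i x, g i (t x) = - g i x) ->
  (forall i s x y, s \in K -> x \in s -> y \in s -> `|g i x - g i y| < d) ->
  c \in inv_cycles K t (size l + N) -> cycle_index K t (size l + N) c 1 ->
  exists K' : {set {set V}}, [/\ Tcomplex K' t, {subset K' <= K},
    forall s x i, s \in K' -> x \in s -> i \in l -> `|g i x| < d &
    exists2 z, z \in inv_cycles K' t N & cycle_index K' t N z 1].
Proof.
move=> d0 + gt; elim: l K c => [|i l IH] K c TC gK cZ c1.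
  by exists K; split=> //; exists c.
pose pos := [pred x | d <= g i x].
have exc s : s \in K -> forall x y, x \in s -> y \in s -> pos x -> ~~ pos (t y).
  move=> sK x y xs ys /= px; rewrite gt -ltNge.
  by have := gK i s x y sK xs ys; rewrite ltr_norml => /andP[]; lra.
have [z zZ z1] := index_reduction TC exc cZ c1.
have := IH _ z (Tcomplex_sub TC _) _ zZ z1.
case.
- by move=> x; rewrite /= (tcK TC) andbC.
- by move=> j s x y; rewrite inE => /andP[sK _]; exact: gK.
- move=> K' [TC' sub' bnd' ex']; exists K'; split=> //.
    by move=> s /sub'; rewrite inE => /andP[].
  move=> s x j sK' xs; rewrite inE => /orP[/eqP ->|jl]; last exact: bnd' sK' xs jl.
  have := sub' s sK'; rewrite inE => /andP[_ /forall_inP/(_ x xs)] /=.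
  by rewrite gt -!ltNge ltr_norml => /andP[]; lra.
Qed.

Lemma nbhs_set_type (X : topologicalType) (Z : set X) (z : Z) (B : set Z) :
  nbhs z B <-> exists W : set X, [/\ open W, W (val z) & val @^-1` W `<=` B].
Proof.
split=> [[_ [[W oW <-] Wz WB]]|[W [oW Wz WB]]]; first by exists W.
by exists (val @^-1` W); split=> //; exists W.
Qed.

Lemma compact_set_type (X : topologicalType) (Z : set X) :
  compact Z -> compact [set: Z].
Proof.
move=> Zc F FF _; have [] := Zc ((val : Z -> X) @ F) _ _.
  rewrite /nbhs /=; apply: (@filterE _ F _ (val @^-1` Z)) => z.
  exact: set_mem (valP z).
move=> x [Zx xF]; exists (exist _ x (mem_set Zx)); split=> // A B FA.
move=> /nbhs_set_type[W [oW /= Wx WB]].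
have FA' : ((val : Z -> X) @ F) (val @` A).
  have sub : A `<=` val @^-1` (val @` A) by move=> a Aa; exists a.
  exact: (@filterS _ F _ _ _ sub FA).
have [_ [[a Aa <-] Wa]] := xF (val @` A) W FA' (open_nbhs_nbhs (conj oW Wx)).
by exists a; split=> //; exact: WB.
Qed.

Section YangTheorem.
Variables (R : realType) (X : topologicalType) (T : X -> X).
Variables (J : finType) (o : J -> X -> R).
Hypotheses (X_compact : compact [set: X]) (o_cont : forall j, continuous (o j)).
Hypotheses (o_odd : forall j x, o j (T x) = - o j x).
Hypotheses (o_sep : forall x y, (forall j, o j x = o j y) -> x = y).
Hypotheses (o_neq0 : forall x, exists j, o j x != 0).
Let TK := T_invol o_odd o_sep.

(** Each rung is half of an invariant cycle and has the next lower doubled rung as its boundary, so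
    the index descends to the single point of [E 0], which counts one. *)
Lemma ladder_cycle N e : 0 < e -> (forall x, ~~ close o e x (T x)) ->
  ladder T o N e ->
  exists (V : {fset X}) (VT : forall x, x \in V -> T x \in V),
  exists2 c, c \in inv_cycles (small_sets o V e) (fsetT VT) N &
    cycle_index (small_sets o V e) (fsetT VT) N c 1.
Proof.
move=> e0 gap [E [Esmall Ebd [x0 E0]]].
pose L := flatten (flatten (map E (iota 0 N.+1))).
pose V := [fset x in L ++ map T L]%fset.
have VE x : (x \in V) = (x \in L) || (x \in map T L) by rewrite !inE.
have VT x : x \in V -> T x \in V.
  rewrite !VE => /orP[xL|/mapP[y yL ->]]; apply/orP.
    by right; apply: map_f.
  by left; rewrite TK.
have EV i s x : (i <= N)%N -> s \in E i -> x \in s -> x \in V.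
  move=> iN sE xs; rewrite VE; apply/orP; left; apply/flattenP; exists s => //.
  apply/flattenP; exists (E i) => //; apply: map_f.
  by rewrite mem_iota add0n ltnS iN.
have x0V : x0 \in V by apply: (EV 0%N [:: x0]); rewrite ?E0 ?mem_head.
(* The default [x0] is never reached: all points of the ladder lie in [V]. *)
pose r (x : X) : V := insubd [` x0V]%fset x.
have rK x : x \in V -> val (r x) = x by move=> xV; rewrite /r insubdK.
exists V, VT; set K := small_sets o V e; set t := fsetT VT.
have TC : Tcomplex K t := small_Tcomplex o_odd o_sep VT gap.
have rT x : x \in V -> r (T x) = t (r x).
  by move=> xV; apply: val_inj; rewrite /= !rK// VT.
pose d i := tau (mp r (E i)).
have dT i : (i <= N)%N -> chain_map t (d i) = tau (mp r (mp T (E i))).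
  move=> iN; rewrite /d chain_map_tau /tau; congr (\sum_(s <- _) _).
  rewrite /mp -!map_comp; apply/eq_in_map => s sE /=; rewrite -!map_comp.
  by apply/eq_in_map => x xs /=; rewrite rT//; exact: EV sE xs.
have dK i : (i <= N)%N -> d i \in chains K i.
  move=> iN; rewrite /d /tau big_map big_seq; apply: chains_sum => s sE.
  have [ss sc] := Esmall i s iN sE.
  have -> : i = (size (map r s)).-1 by rewrite size_map ss.
  apply: simp_chains; apply/small_setsP; split.
    case: s ss {sc} sE => // x s _ _; apply/set0Pn; exists (r x).
    by rewrite inE mem_head.
  move=> x' y'; rewrite !inE => /mapP[x xs ->] /mapP[y ys ->].
  by rewrite !rK ?(EV _ _ _ iN sE)//; exact: sc.
have db i : (i < N)%N -> boundary (d i.+1) = d i + chain_map t (d i).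
  move=> iN; rewrite (dT _ (ltnW iN)) /d -tau_cat boundary_tau bd_mp -mp_cat.
  by apply: tau_eqc; apply: mp_eqc; exact: Ebd.
have d1 i : (i <= N)%N -> cycle_index K t i (d i + chain_map t (d i)) 1.
  elim: i => [|i IH] iN /=.
    exists (d 0%N); split; rewrite ?dK//.
    by rewrite -/(csum _) /d E0 /tau big_seq1 csum_simp.
  by exists (d i.+1); rewrite dK// db//; split => //; apply: IH; exact: ltnW.
exists (d N + chain_map t (d N)); last exact: d1.
have /inv_chainsP[cK ct] := inv_chains_double TC (dK N (leqnn N)).
apply/inv_cyclesP; split=> //; rewrite raddfD /= (boundaryT t (dK N (leqnn N))).
(* For positive [N] the boundary of [d N] is itself invariant, so that it cancels with its image. *)
suff -> : boundary (d N) + chain_map t (boundary (d N)) = 0 by [].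
have [->|N0] := posnP N.
  by rewrite /d E0 boundary_tau /tau /= big_seq1 simp_nil raddf0 addr0.
have NK : N.-1.+1 = N by rewrite prednK.
rewrite -NK (db N.-1) ?NK// raddfD /= (chain_mapTK TC) addrC.
by rewrite [chain_map t _ + _]addrC addcc.
Qed.

Section ZeroSet.
Variables (m N : nat) (h : 'I_m -> X -> R).
Hypotheses (h_cont : forall i, continuous (h i)) (mN : (m <= N)%N).
Hypotheses (h_odd : forall i x, h i (T x) = - h i x).
Hypothesis ladders : forall e, 0 < e -> ladder T o N e.

Variables (Z : set X) (TZ : T @` Z = Z).
Hypothesis ZE : forall x, Z x <-> forall i, h i x = 0.

Lemma zero_closed : closed Z.
Proof.
have -> : Z = \bigcap_i (h i @^-1` [set 0]).
  by rewrite eqEsubset; split => x; [move=> /ZE H i _; exact: H|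
    move=> H; apply/ZE => i; exact: (H i)].
apply: closed_bigI => i _.
have /continuous_closedP := @h_cont i; apply.
by apply: accessible_closed_set1; apply: hausdorff_accessible; exact: Rhausdorff.
Qed.

Lemma zero_compact : compact Z.
Proof. exact: subclosed_compact zero_closed X_compact _. Qed.

Lemma restrict_Tspace : is_Tspace (restrictT TZ).
Proof.
split.
- exact: compact_set_type zero_compact.
- move=> p q pq; apply: val_inj; apply: (coord_hausdorff o_cont o_sep) => A B.
  rewrite !nbhsE => -[C [oC Cp] CA] [D [oD Dq] DB].
  have [||a [Ca Da]] := pq (val @^-1` C) (val @^-1` D).
  - by apply/nbhs_set_type; exists C; split=> // z.
  - by apply/nbhs_set_type; exists D; split=> // z.
  - by exists (val a); split; [exact: CA|exact: DB].
- move=> x B /nbhs_set_type[W [oW Wx WB]].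
  have := T_continuous X_compact o_cont o_odd o_sep (open_nbhs_nbhs (conj oW Wx)).
  rewrite /= nbhs_filterE nbhsE => -[C [oC Cx] CW].
  by apply/nbhs_set_type; exists C; split=> // z Cz; apply: WB; exact: CW.
- by move=> x; apply: val_inj; rewrite /= TK.
- by move=> x /(congr1 val) /=; exact: T_neq.
Qed.

Lemma lebesgue_number (u : Tcover (restrictT TZ)) : exists2 e, 0 < e &
  forall x, Z x -> exists A : vertex u, forall y : Z, close o e x (val y) -> (val A) y.
Proof.
have [] := @near_covering_right R X Z (fun e x =>
  exists A : vertex u, forall y : Z, close o e x (val y) -> (val A) y) zero_compact.
  move=> x Zx; pose z : Z := exist _ x (mem_set Zx).
  have [A Au Az] := members_cover u z.
  have [W [oW WA]] : exists W : set X, open W /\ val @^-1` W = A.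
    by have := member_open Au; rewrite /open /= => -[W oW <-]; exists W.
  have Wx : W x by have : (val @^-1` W) z by rewrite WA.
  have [e e0 H] := nbhs_close X_compact o_cont o_sep (open_nbhs_nbhs (conj oW Wx)).
  exists (e / 2); first by rewrite divr_gt0.
  apply: filterS (@near_close _ _ _ _ o_cont (e / 2) x _); last by rewrite divr_gt0.
  move=> y xy r r0 re; exists [` Au]%fset => w yw /=; rewrite -WA /=.
  by apply: H; apply: close_le (close_trans xy yw); lra.
by move=> e e0 H; exists e.
Qed.

(** A point of [Z] serves all points near it; near any other point some [h i] is bounded away from
    zero. Compactness gives a common [d]. *)
Lemma near_zero e : 0 < e -> exists2 d, 0 < d &
  forall x, (forall i, `|h i x| < d) -> exists2 z, Z z & close o e x z.
Proof.
move=> e0.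
have [] := @near_covering_right R X setT (fun d x =>
  (forall i, `|h i x| < d) -> exists2 z, Z z & close o e x z) X_compact.
  move=> x _; have [Zx|nZ] := pselect (Z x).
    exists 1 => //; apply: filterS (@near_close _ _ _ _ o_cont e x _) => //.
    by move=> y xy d _ _ _; exists x => //; rewrite close_sym.
  have [i hi] : exists i, h i x <> 0.
    by apply: contrapT => H; apply: nZ; apply/ZE => i; apply: contrapT => ?;
      apply: H; exists i.
  have c0 : 0 < `|h i x| by rewrite normr_gt0; apply/eqP.
  have c2 : 0 < `|h i x| / 2 by rewrite divr_gt0.
  exists (`|h i x| / 2) => //.
  have /cvgrPdist_lt/(_ _ c2) := @h_cont i x; apply: filterS => y xy d d0 dh hd.
  have := hd i; have := ler_normD (h i x - h i y) (h i y).
  by rewrite subrK; lra.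
by move=> d d0 H; exists d => // x; exact: H.
Qed.

(** A fine cycle of dimension [N] is reduced by the functions [h i] to one near [Z]. Each of its
    vertices is sent to a member of the cover that contains all points of [Z] near that vertex. *)
Lemma cover_cycle (u : Tcover (restrictT TZ)) :
  exists2 c, c \in inv_cycles (nerve u) (@vertexT _ _ u) (N - m) &
    cycle_index (nerve u) (@vertexT _ _ u) (N - m) c 1.
Proof.
have [e1 e10 leb] := lebesgue_number u.
have e30 : 0 < e1 / 3 by rewrite divr_gt0.
have [d d0 nearZ] := near_zero e30.
have [c c0 gap] := coord_gap X_compact o_cont o_odd o_neq0.
have [e4 e40 unif] : exists2 e, 0 < e & forall i x y, close o e x y -> `|h i x - h i y| < d.
  have /choice[e eP] : forall i, exists e, 0 < e /\ forall x y, close o e x y -> `|h i x - h i y| < d.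
    move=> i; have [e e0 H] := unif_continuous X_compact o_cont o_sep (@h_cont i) d0.
    by exists e.
  exists (\big[Order.min/1]_i e i).
    by apply/bigmin_gtP; split=> // i _; case: (eP i).
  move=> i x y xy; apply: (eP i).2; apply: close_le xy; exact: bigmin_le.
(* Scale [c] makes the complex free and [e4] makes each [h i] oscillate by less than [d]. The
   Lebesgue number [e1] is split in three: one third from a vertex to [Z], and two thirds from a
   vertex to the points its chosen member must contain. *)
pose e := Order.min (e1 / 3) (Order.min c e4).
have e0 : 0 < e by rewrite !lt_min e30 c0 e40.
have ee1 : e <= e1 / 3 by rewrite ge_min lexx.
have ec : e <= c by rewrite !ge_min lexx orbT.
have ee4 : e <= e4 by rewrite !ge_min lexx !orbT.
have egap x : ~~ close o e x (T x) by apply: contraNN (gap x); exact: close_le.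
have [V [VT [z zZ z1]]] := ladder_cycle e0 egap (ladders e0).
set K := small_sets o V e in zZ z1; set t := fsetT VT in zZ z1.
have TC : Tcomplex K t := small_Tcomplex o_odd o_sep VT egap.
have Nm : N = (size (enum 'I_m) + (N - m))%N by rewrite size_enum_ord subnKC.
rewrite {1}Nm in zZ; rewrite {1}Nm in z1.
have [|i s x y|K' [TC' subK bnd [z' zZ' z1']]] :=
  iterated_reduction (g := fun i (x : V) => h i (val x)) d0 TC _ _ zZ z1.
- by move=> i x; rewrite /= h_odd.
- move=> /small_setsP[_ H] xs ys; apply: unif; apply: close_le ee4 _; exact: H.
have good s x : s \in K' -> x \in s ->
    exists A : vertex u, forall y : Z, close o (e1 / 3 + e1 / 3) (val x) (val y) -> (val A) y.
  move=> sK xs; have [i|w Zw xw] := nearZ (val x).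
    by apply: (bnd s x i) => //; rewrite mem_enum.
  have [A HA] := leb w Zw; exists A => y xy; apply: HA.
  apply: close_le (close_trans _ xy); last by rewrite close_sym; exact: xw.
  lra.
have [s0 s0K /set0Pn[x0 x0s]] : exists2 s, s \in K' & s != finset.set0.
  by apply: cycle_index_neq0 z1' _.
have [A0 _] := good _ _ s0K x0s.
pose inK' x := `[< exists2 s, s \in K' & x \in s >].
have /choice[q qP] : forall x : V, exists A : vertex u, inK' x ->
    forall y : Z, close o (e1 / 3 + e1 / 3) (val x) (val y) -> (val A) y.
  move=> x; have [/asboolP[s sK xs]|nx] := boolP (inK' x).
    by have [A HA] := good s x sK xs; exists A.
  by exists A0.
pose b (x : V) := (enum_rank x < enum_rank (t x))%N.
pose p x := if b x then q x else vertexT (q (t x)).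
have inK'T x : inK' x -> inK' (t x).
  move=> /asboolP[s sK xs]; apply/asboolP; exists (t @: s); last exact: imset_f.
  exact: (tc_inv TC').
have pP x : inK' x ->
    forall y : Z, close o (e1 / 3 + e1 / 3) (val x) (val y) -> (val (p x)) y.
  move=> xK y xy; rewrite /p; case: ifP => _; first exact: qP.
  exists (restrictT TZ y); last by apply: val_inj; rewrite /= TK.
  by apply: (qP _ (inK'T _ xK)); rewrite /= closeT.
have pT x : inK' x -> p (t x) = vertexT (p x).
  move=> /asboolP[s sK xs]; rewrite /p /b (tcK TC').
  case: ltngtP => [||/val_inj/enum_rank_inj tx].
  - by rewrite vertexTK// => y; apply: val_inj; rewrite /= TK.
  - by [].
  - have : [set x]%SET \in K'.
      apply: (tc_face TC' sK); first by rewrite finset.sub1set.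
      by apply/set0Pn; exists x; rewrite inE.
    by move=> /(tc_free TC')/eqP[]; rewrite imset_set1 tx.
have pS : simplicial K' (nerve u) p.
  move=> s sK; have sne : s != finset.set0.
    by apply: contraTneq sK => ->; exact: (tc_neq0 TC').
  have /set0Pn[x xs] := sne.
  have [i|w Zw xw] := nearZ (val x).
    by apply: (bnd s x i) => //; rewrite mem_enum.
  apply/nerveP; split; first by rewrite imset_eq0.
  (* The point [w] of [Z] near one vertex is within two thirds of [e1] of every vertex of the
     simplex, so all chosen members contain it. *)
  exists (exist _ w (mem_set Zw)) => _ /imsetP[y ys ->].
  apply: pP; first by apply/asboolP; exists s.
  apply: close_trans xw; apply: close_le ee1 _.
  by have /small_setsP[_] := subK _ sK; apply.
have pE : equivariant K' t (@vertexT _ _ u) p.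
  by move=> s x sK xs; apply: pT; apply/asboolP; exists s.
exists (chain_map p z'); first exact: inv_cycles_map zZ'.
exact: cycle_index_map z1'.
Qed.

(** The sets where a coordinate has a given sign: the involution exchanges the two signs, and no
    point has all coordinates zero. Empty sets are discarded. *)
Lemma Tcover_ex : Tcover (restrictT TZ).
Proof.
pose F (jb : J * bool) : set Z := [set z | 0 < (-1) ^+ jb.2 * o jb.1 (val z)].
pose nonempty (C : set Z) := `[< C !=set0 >].
pose M := [fset C in [fset F jb | jb in {: J * bool}] | nonempty C]%fset.
have MP C : reflect (C !=set0 /\ exists jb, C = F jb) (C \in M).
  rewrite !inE /=; apply: (iffP andP).
    by move=> [/imfsetP[jb _ ->] /asboolP C0]; split=> //; exists jb.
  move=> [C0 [jb e]]; split; last exact/asboolP.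
  by apply/imfsetP; exists jb.
have TF jb : restrictT TZ @` F jb = F (jb.1, ~~ jb.2).
  case: jb => j b; rewrite eqEsubset; split => [_ [z Fz <-]|z Fz] /=.
    by rewrite /F /= o_odd signrN mulrNN.
  exists (restrictT TZ z); last by apply: val_inj; rewrite /= TK.
  by move: Fz; rewrite /F /= o_odd signrN mulrN mulNr.
have FI jb : F jb `&` F (jb.1, ~~ jb.2) = set0.
  rewrite -subset0 => z [] /=; rewrite /F /= signrN mulNr oppr_gt0.
  by move=> /lt_trans H /H; rewrite ltxx.
have Mopen A : A \in M -> open A.
  move=> /MP[_ [[j b] ->]].
  exists [set x | 0 < (-1) ^+ b * o j x] => //.
  have c : continuous (fun x => (-1) ^+ b * o j x).
    by move=> x; apply: cvgM; [exact: cvg_cst|exact: o_cont].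
  by have /continuousP H := c; exact: (H _ (@open_gt R 0)).
have Mneq0 A : A \in M -> A !=set0 by move=> /MP[].
have Mcover x : exists2 A, A \in M & A x.
  have [j oj] := o_neq0 (val x).
  exists (F (j, o j (val x) < 0)); last by rewrite /F /= -normrEsign normr_gt0.
  apply/MP; split; last by eexists.
  by exists x; rewrite /F /= -normrEsign normr_gt0.
have Minv A : A \in M -> restrictT TZ @` A \in M.
  move=> /MP[[x Ax] [jb e]]; apply/MP; split.
    by exists (restrictT TZ x); exists x.
  by exists (jb.1, ~~ jb.2); rewrite e TF.
have Mfree A : A \in M -> A `&` restrictT TZ @` A = set0.
  by move=> /MP[_ [jb ->]]; rewrite TF FI.
exact: TCover Mopen Mneq0 Mcover Minv Mfree.
Qed.

(** Degree N - m is nontrivial by [cover_cycle], and the vertices of one cover bound the nontrivial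
    degrees, so a largest one exists. *)
Theorem yang : is_Tspace (restrictT TZ) /\
  exists2 k, is_Yang_index (restrictT TZ) k & (N - m <= k)%N.
Proof.
split; first exact: restrict_Tspace.
have rK : involutive (restrictT TZ) by move=> x; apply: val_inj; rewrite /= TK.
have ex := index_nontrivial_of rK Tcover_ex cover_cycle.
have bnd k := @index_nontrivial_bound _ _ rK k Tcover_ex.
pose P k := `[< index_nontrivial (restrictT TZ) k >].
have exP : exists k, P k by exists (N - m)%N; apply/asboolP.
have bndP k : P k -> (k <= #|vertex Tcover_ex|)%N by move=> /asboolP/bnd/ltnW.
case: (ex_maxnP exP bndP) => k /asboolP kP kmax.
exists k; last by apply: kmax; apply/asboolP.
by split=> // j jP; apply: kmax; apply/asboolP.
Qed.

End ZeroSet.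
End YangTheorem.

(** * Paths on the circle *)

Section SweepMembership.
Variables (I Y W : eqType).
Implicit Types (g : I -> Y -> W) (i : I) (p : seq I) (l : seq (seq Y)).

Lemma sweep_mem (e : rel I) g i p l r : path e i p -> r \in sweep g i p l ->
  exists a b s, [/\ e a b, s \in l & r \in pr (g a) (g b) s].
Proof.
elim: p i => //= j p IH i /andP[ij jp]; rewrite mem_cat => /orP[|/(IH _ jp)//].
by move=> /flattenP[_ /mapP[s sl ->] rs]; exists i, j, s.
Qed.

Lemma eq_sweep g g' i p l :
  (forall a s y, a \in i :: p -> s \in l -> y \in s -> g a y = g' a y) ->
  sweep g i p l = sweep g' i p l.
Proof.
elim: p i => //= j p IH i H; rewrite IH; last first.
  by move=> a s y aj; apply: H; rewrite inE aj orbT.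
congr (_ ++ _); congr flatten; apply/eq_in_map => s sl.
have := @pr_equi Y W Y W id id (g i) (g j) (g' i) (g' j) s.
rewrite map_id /mp (eq_map (g := id)) ?map_id; last by move=> r; rewrite /= map_id.
apply => y ys; apply: (H _ s) => //; first exact: mem_head.
by rewrite !inE eqxx orbT.
Qed.

Lemma mp_sweep (V : Type) (h : W -> V) g i p l :
  mp h (sweep g i p l) = sweep (fun a y => h (g a y)) i p l.
Proof.
rewrite -[in RHS](_ : mp id l = l); last first.
  by rewrite /mp (eq_map (g := id)) ?map_id// => s; rewrite /= map_id.
exact: sweep_equi.
Qed.

End SweepMembership.

Section CirclePaths.
Variable R : realType.
Implicit Types (a b : R * R) (d : R).

Definition oncircle a := a.1 ^+ 2 + a.2 ^+ 2 == 1.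

Definition cstep d a b := [&& oncircle a, oncircle b,
  `|a.1 - b.1| <= d & `|a.2 - b.2| <= d].

(* Rational parametrization of the quarter circle, for 0 <= t <= 1. *)
Definition cpoint (t : R) : R * R :=
  ((1 - t ^+ 2) / (1 + t ^+ 2), t *+ 2 / (1 + t ^+ 2)).

Lemma cpoint_oncircle t : oncircle (cpoint t).
Proof.
have t0 : 1 + t ^+ 2 != 0 by rewrite gt_eqF// ltr_wpDr// sqr_ge0.
by apply/eqP; rewrite /= !expr_div_n -mulrDl mulr2n; field.
Qed.

(** Both coordinates have Lipschitz constant 2: their differences factor as 2 (t - s) times a
    quotient of absolute value at most one. *)
Lemma cpoint_step d s t : 0 <= s <= 1 -> 0 <= t <= 1 -> `|s - t| <= d / 2 ->
  cstep d (cpoint s) (cpoint t).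
Proof.
move=> /andP[s0 s1] /andP[t0 t1] st.
rewrite /cstep !cpoint_oncircle /=.
have S : 0 < 1 + s ^+ 2 by rewrite ltr_wpDr// sqr_ge0.
have T : 0 < 1 + t ^+ 2 by rewrite ltr_wpDr// sqr_ge0.
have ST : 0 < (1 + s ^+ 2) * (1 + t ^+ 2) by rewrite mulr_gt0.
have bnd (x : R) : `|x| <= (1 + s ^+ 2) * (1 + t ^+ 2) ->
    `|(t - s) *+ 2 * x / ((1 + s ^+ 2) * (1 + t ^+ 2))| <= d.
  move=> xle; rewrite -mulrA normrM normrMn.
  have -> : d = (d / 2) *+ 2 * 1 by rewrite mulr1 -mulr_natr mulfVK.
  apply: ler_pM => //; rewrite ?mulrn_wge0//.
    by rewrite lerMn2r /= distrC.
  by rewrite normrM normfV (gtr0_norm ST) ler_pdivrMr// mul1r.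
apply/andP; split.
  have -> : (1 - s ^+ 2) / (1 + s ^+ 2) - (1 - t ^+ 2) / (1 + t ^+ 2) =
      (t - s) *+ 2 * (s + t) / ((1 + s ^+ 2) * (1 + t ^+ 2)).
    by rewrite mulr2n; field; rewrite !gt_eqF.
  by apply: bnd; rewrite ger0_norm ?addr_ge0//; nra.
have -> : s *+ 2 / (1 + s ^+ 2) - t *+ 2 / (1 + t ^+ 2) =
    (t - s) *+ 2 * (s * t - 1) / ((1 + s ^+ 2) * (1 + t ^+ 2)).
  by rewrite !mulr2n; field; rewrite !gt_eqF.
by apply: bnd; rewrite ler_norml; apply/andP; split; nra.
Qed.

Lemma quarter_path d : 0 < d -> exists p,
  path (cstep d) (1, 0) p /\ last (1, 0) p = (0, 1).
Proof.
(* Then 1 / [M] is at most d / 2, the parameter step that [cpoint_step] allows. *)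
move=> d0; pose M := (Num.bound (2 / d)).+1.
have M0 : 0 < M%:R :> R by rewrite ltr0n.
have Md : M%:R^-1 <= d / 2.
  rewrite -[leRHS]invrK lef_pV2 ?posrE ?invr_gt0 ?divr_gt0// invf_div.
  apply: ltW; apply: (lt_le_trans (archi_boundP _)); first by rewrite divr_ge0// ltW.
  by rewrite ler_nat leqnSn.
pose g (j : nat) := cpoint (j%:R / M%:R).
have g0 : g 0%N = (1, 0) by rewrite /g /cpoint mul0r expr0n /= subr0 addr0 divr1 mul0rn mul0r.
have gM : g M = (0, 1).
  rewrite /g /cpoint divff ?gt_eqF// expr1n subrr mul0r; congr (_, _).
  by rewrite divff// gt_eqF// ltr_wpDr.
exists (map g (iota 1 M)); rewrite -g0; split; last first.
  rewrite last_map -gM; congr g; rewrite (last_nth 0%N) size_iota.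
  by rewrite -[LHS]/(nth 0%N (iota 1 M) M.-1) nth_iota.
rewrite path_map; apply/(pathP 0%N) => i; rewrite size_iota => iM.
have -> : nth 0%N (0%N :: iota 1 M) i = i 
  by case: i iM => // i iM; rewrite -[LHS]/(nth 0%N (iota 1 M) i) nth_iota// ltnW.
rewrite nth_iota// add1n /g /=; apply: cpoint_step.
- by rewrite divr_ge0//= ler_pdivrMr// mul1r ler_nat ltnW.
- by rewrite divr_ge0//= ler_pdivrMr// mul1r ler_nat.
- rewrite -mulrBl -natr1 opprD addrA subrr add0r mulN1r normrN gtr0_norm//.
  by rewrite invr_gt0.
Qed.

Definition crot a : R * R := (- a.2, a.1).

Lemma half_path d : 0 < d -> exists p,
  path (cstep d) (1, 0) p /\ last (1, 0) p = (-1, 0).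
Proof.
move=> d0; have [p [pp lp]] := quarter_path d0.
have r1 : (0, 1) = crot (1, 0) by rewrite /crot /= oppr0.
exists (p ++ map crot p); rewrite cat_path pp lp last_cat lp r1 last_map lp; split=> //=.
rewrite path_map; apply: sub_path pp => a b /=.
rewrite /cstep /oncircle /= !sqrrN -opprD normrN ![a.2 ^+ 2 + _]addrC ![b.2 ^+ 2 + _]addrC.
by case/and4P => -> -> -> ->.
Qed.

End CirclePaths.

(** * Pluecker coordinates *)

Section Pluecker.
Local Open Scope quotient_scope.
Variables (R : realType) (n : nat).
Local Notation Stf := (@Stiefel R n 2).
Local Notation G := (Gr R n 2).
Implicit Types (v : 'M[R]_(n, 2)) (P : G) (j : 'I_n * 'I_n).

Definition pl v j : R := v j.1 0 * v j.2 1 - v j.1 1 * v j.2 0.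

Lemma det_mx2 (g : 'M[R]_2) : \det g = g 0 0 * g 1 1 - g 0 1 * g 1 0.
Proof.
rewrite (expand_det_row _ 0) !big_ord_recl big_ord0 addr0 /cofactor !det_mx11.
rewrite !mxE /= expr0 mul1r expr1 mulN1r mulrN.
have e1 : lift ord0 ord0 = 1 :> 'I_2 by exact: val_inj.
have e0 : lift 1 0 = 0 :> 'I_2 by exact: val_inj.
by rewrite -![ord0]/(0 : 'I_2) !e1 e0.
Qed.

Lemma pl_mulmx v (g : 'M[R]_2) j : pl (v *m g) j = \det g * pl v j.
Proof.
rewrite /pl det_mx2 !mxE !big_ord_recl !big_ord0.
rewrite (_ : lift ord0 ord0 = 1 :> 'I_2); last exact: val_inj.
by rewrite -[ord0]/(0 : 'I_2); ring.
Qed.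

Definition pmx v : 'M[R]_n := \matrix_(i, j) pl v (i, j).

Let Jm : 'M[R]_2 := \matrix_(i, j) ((i == 0) && (j == 1))%:R - 
  \matrix_(i, j) ((i == 1) && (j == 0))%:R.

Lemma pmxE v : pmx v = v *m Jm *m v^T.
Proof.
apply/matrixP => i j; rewrite !mxE !big_ord_recl big_ord0 !mxE !big_ord_recl !big_ord0.
rewrite (_ : lift ord0 ord0 = 1 :> 'I_2); last exact: val_inj.
by rewrite !mxE /pl /= -[ord0]/(0 : 'I_2); ring.
Qed.

Lemma Jm_sq : Jm *m Jm^T = 1%:M.
Proof.
apply/matrixP => -[[|[|//]] i] [[|[|//]] j]; rewrite !mxE !big_ord_recl big_ord0 !mxE /=;
  rewrite ?mulr0n ?mulr1n ; ring.
Qed.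

(** The right side is the orthogonal projection onto the plane, which the Pluecker matrix v J v^T
    thus determines, J being a rotation by a right angle. *)
Lemma pmx_proj v : Stf v -> pmx v *m (pmx v)^T = v *m v^T.
Proof.
move=> vS; rewrite pmxE !trmx_mul trmxK !mulmxA -(mulmxA _ v^T v).
by rewrite vS mulmx1 -(mulmxA v Jm) Jm_sq mulmx1.
Qed.

(** Equal projections give w = v g with g = v^T w orthogonal. The Pluecker matrix scales by det g,
    and compressing it by v to the nonzero matrix [Jm] forces det g = 1. *)
Lemma pl_inj v w : Stf v -> Stf w -> pl v =1 pl w ->
  exists2 g, SO g & w = v *m g.
Proof.
move=> vS wS vw; have e : pmx v = pmx w by apply/matrixP => i j; rewrite !mxE vw.
have pe : v *m v^T = w *m w^T by rewrite -pmx_proj// e pmx_proj.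
have we : w = v *m (v^T *m w) by rewrite mulmxA pe -mulmxA wS mulmx1.
exists (v^T *m w) => //; split.
  by rewrite trmx_mul trmxK mulmxA -(mulmxA _ v) pe mulmxA wS mul1mx.
set g := v^T *m w in we *.
have := congr1 (fun M => v^T *m M *m v) e; rewrite /= we.
have -> : pmx (v *m g) = \det g *: pmx v.
  by apply/matrixP => i j; rewrite !mxE pl_mulmx.
rewrite -scalemxAr -scalemxAl pmxE.
have -> : v^T *m (v *m Jm *m v^T) *m v = Jm.
  by rewrite !mulmxA vS mul1mx -mulmxA vS mulmx1.
move=> /matrixP/(_ 0 1); rewrite !mxE /= subr0 mulr1 => <-.
by [].
Qed.

Definition coord j P : R := pl (val (repr P)) j.

Lemma coord_pi (v : Stf) j : coord j (\pi_G v) = pl (val v) j.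
Proof.
have [g [_ dg] vg] : exists2 g, SO g & \val (repr (\pi_G v)) = \val v *m g.
  apply/asboolP.
  have /eqmodP : v = repr (\pi_G v) %[mod {eq_quot same_SO_orbit_rel R n 2}].
    by rewrite [RHS](@reprK _ G).
  by [].
by rewrite /coord vg pl_mulmx dg mul1r.
Qed.

Lemma coord_odd j P : coord j (GrT P) = - coord j P.
Proof.
rewrite -[P](@reprK _ G) GrT_pi !coord_pi /= pl_mulmx det_flip_mx//.
by rewrite mulN1r.
Qed.

Lemma coord_sep P Q : (forall j, coord j P = coord j Q) -> P = Q.
Proof.
move=> PQ; rewrite -[P](@reprK _ G) -[Q](@reprK _ G); apply/eqmodP/asboolP.
by apply: pl_inj => //; exact: set_mem (valP _).
Qed.

Lemma coord_neq0 P : exists j, coord j P != 0.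
Proof.
apply: contrapT => H; have vS : Stf (val (repr P)) := set_mem (valP _).
have e : pmx (val (repr P)) = 0.
  apply/matrixP => i j; rewrite !mxE; apply/eqP/negPn/negP => ij.
  by apply: H; exists (i, j).
have := pmx_proj vS; rewrite e mul0mx => /(congr1 (fun M => (val (repr P))^T *m M *m val (repr P))).
rewrite mulmx0 mul0mx !mulmxA vS mul1mx vS => /matrixP/(_ 0 0).
by rewrite !mxE /= => /esym/eqP; rewrite oner_eq0.
Qed.

Lemma coord_continuous_Gr j : continuous (coord j).
Proof.
apply/quotient_continuous.
rewrite (_ : coord j \o _ = (fun v => pl v j) \o val); last first.
  by apply/funext => v; exact: coord_pi.
move=> v; apply: (@continuous_comp Stf 'M[R]_(n, 2) R val (pl^~ j)).
  exact: initial_continuous.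
by apply: continuousB; apply: continuousM; exact: coord_continuous.
Qed.

(** Flattened to row vectors, frames form a closed subset of a cube, since their columns are unit
    vectors. *)
Lemma Stiefel_compact : compact Stf.
Proof.
have -> : Stf = vec_mx @` [set r : 'rV[R]_(n * 2) | Stf (vec_mx r)].
  rewrite eqEsubset; split => [v vS|_ [r rS <-]//].
  by exists (mxvec v); rewrite /= mxvecK.
apply: continuous_compact.
  apply: continuous_subspaceT => r A [B rB BA].
  have H i a : nbhs r [set s : 'rV[R]_(n * 2) | B i a (vec_mx s i a)].
    have -> : [set s : 'rV[R]_(n * 2) | B i a (vec_mx s i a)] =
        (fun s : 'rV[R]_(n * 2) => s 0 (mxvec_index i a)) @^-1` B i a.
      by apply/funext => s; rewrite /= mxE.
    by have := rB i a; rewrite mxE => /(@coord_continuous _ _ _ 0 (mxvec_index i a) r).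
  have := @filter_forall _ _ _ (nbhs r) _
    (fun i => @filter_forall _ _ _ (nbhs r) _ (H i)).
  have sub : [set s : 'rV[R]_(n * 2) | forall i a, B i a (vec_mx s i a)] `<=`
    vec_mx @^-1` A by move=> s sB; exact: BA.
  by move=> H'; apply: (@filterS _ (nbhs r) _ _ _ sub (H' _ _)).
apply: (@subclosed_compact _ _ [set r : 'rV[R]_(n * 2) | forall i, `[-1, 1]%classic (r ord0 i)]).
- have -> : [set r : 'rV[R]_(n * 2) | Stf (vec_mx r)] =
      \bigcap_(k : 'I_2 * 'I_2) [set r : 'rV[R]_(n * 2) |
        \sum_i vec_mx r i k.1 * vec_mx r i k.2 = (k.1 == k.2)%:R].
    rewrite eqEsubset; split => r /= rS.
      move=> [a b] _ /=; move/matrixP/(_ a b): rS; rewrite !mxE => <-.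
      by apply: eq_bigr => i _; rewrite !mxE.
    apply/matrixP => a b; rewrite !mxE -(rS (a, b) I) /=.
    by apply: eq_bigr => i _; rewrite !mxE.
  apply: closed_bigI => -[a b] _ /=.
  have c : continuous (fun r : 'rV[R]_(n * 2) => \sum_i vec_mx r i a * vec_mx r i b).
    have vc d i : continuous (fun r : 'rV[R]_(n * 2) => vec_mx r i d : R).
      rewrite (_ : (fun r => _) = (fun r : 'rV[R]_(n * 2) => r 0 (mxvec_index i d))).
        exact: coord_continuous.
      by apply/funext => s; rewrite mxE.
    apply: (@continuous_big _ _ _ _ _ add_continuous) => i _ r.
    by apply: continuousM; exact: vc.
  have /continuous_closedP H := c; exact: (H [set (a == b)%:R] (@closed_eq R _)).
- apply: (@rV_compact R (n * 2) (fun=> `[-1, 1]%classic)) => i.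
  exact: segment_compact.
- move=> r /= rS i; case/mxvec_indexP: i => i a.
  move/matrixP/(_ a a): rS; rewrite !mxE eqxx (bigD1 i)//= !mxE => e.
  have : 0 <= \sum_(k < n | k != i) (vec_mx r)^T a k * vec_mx r k a.
    by apply: sumr_ge0 => k _; rewrite mxE -expr2 sqr_ge0.
  rewrite in_itv /=; set x := r _ _ in e *; move: e.
  set S := \sum_(k < n | _) _ => e S0; apply/andP; split; nra.
Qed.

Lemma Gr_compact : compact [set: G].
Proof.
rewrite (_ : [set: G] = \pi_G @` [set: Stf]); last first.
  by rewrite eqEsubset; split => // P _; exists (repr P) => //; exact: reprK.
apply: continuous_compact; last exact: compact_set_type Stiefel_compact.
by apply: continuous_subspaceT; exact: pi_continuous.
Qed.

End Pluecker.

(** * Hemispheres *)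

Section Hemispheres.
Variables (R : realType) (q : nat).
Local Notation Y := 'rV[R]_(q.+2).
Implicit Types (y : Y) (a b : R * R) (i : 'I_(q.+2)).

Definition pole k : Y := delta_mx 0 (inord (q.+1 - k)).

Definition cone k a y : Y := a.1 *: pole k + a.2 *: y.

Definition antipode : Y -> Y := -%R.

(* The unit sphere of the last k + 1 coordinates. *)
Definition in_sphere k y := \sum_i y 0 i ^+ 2 = 1 /\
  forall i, (i < q.+1 - k)%N -> y 0 i = 0.

Variable p : seq (R * R).

(* hemi k is a fine triangulation of the half {y_(q+1-k) >= 0} of that       *)
(* sphere, namely the cone from the pole over hemi (k-1) + - hemi (k-1).     *)
Fixpoint hemi k : seq (seq Y) :=
  if k is k'.+1 then
    sweep (cone k) (1, 0) p (hemi k' ++ mp antipode (hemi k'))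
  else [:: [:: pole 0]].

Lemma pole_sphere k : (k <= q.+1)%N -> in_sphere k (pole k).
Proof.
move=> kq; split.
  rewrite (bigD1 (inord (q.+1 - k)))//= big1 => [|i ik]; rewrite mxE eqxx.
    by rewrite eqxx expr1n addr0.
  by rewrite (negPf ik) expr0n.
move=> i ik; rewrite mxE eqxx /=; case: eqP => // e.
by move: ik; rewrite e inordK ?ltnn// ltnS leq_subr.
Qed.

Lemma antipode_sphere k y : in_sphere k y -> in_sphere k (antipode y).
Proof.
move=> [y1 y0]; split=> [|i ik]; last by rewrite mxE y0// oppr0.
by rewrite -[RHS]y1; apply: eq_bigr => i _; rewrite mxE sqrrN.
Qed.

Lemma cone_sphere k a y : (k <= q)%N -> oncircle a -> in_sphere k y ->
  in_sphere k.+1 (cone k.+1 a y).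
Proof.
move=> kq /eqP a1 [y1 y0]; have [p1 p0] := @pole_sphere k.+1 kq.
split; last first.
  move=> i ik; rewrite !mxE y0; last by lia.
  by have := p0 i ik; rewrite !mxE => ->; rewrite !mulr0 addr0.
rewrite -a1 -[a.1 ^+ 2]mulr1 -[a.2 ^+ 2]mulr1 -{1}p1 -y1 !mulr_sumr -big_split /=.
apply: eq_bigr => i _; rewrite !mxE eqxx /=.
case: eqP => [->|_]; last by rewrite /=; ring.
by rewrite y0 /=; [ring|rewrite inordK; lia].
Qed.

Lemma sqr_le1_norm (x : R) : x ^+ 2 <= 1 -> `|x| <= 1.
Proof. by rewrite -real_normK ?num_real// expr_le1. Qed.

Lemma oncircle_le1 a : oncircle a -> `|a.1| <= 1 /\ `|a.2| <= 1.
Proof.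
move=> /eqP a1; have := sqr_ge0 a.1; have := sqr_ge0 a.2 => ? ?.
by split; apply: sqr_le1_norm; lra.
Qed.

Lemma sphere_le1 k y i : in_sphere k y -> `|y 0 i| <= 1.
Proof.
move=> [y1 _]; apply: sqr_le1_norm.
by rewrite -y1 (bigD1 i)//= lerDl sumr_ge0// => j _; rewrite sqr_ge0.
Qed.

Variable d : R.
Hypotheses (d0 : 0 <= d) (pP : path (cstep d) (1, 0) p).
Hypothesis p_last : last (1, 0) p = (0, 1).

(** Each cone adds at most 2 [d] to the mesh, one [d] for the coefficient of the pole and one for
    that of the base point, as all coordinates are bounded by one. *)
Lemma hemi_spec k s : (k <= q)%N -> s \in hemi k ->
  [/\ size s = k.+1, {in s, forall y, in_sphere k y} &
    forall (x y : Y) i, x \in s -> y \in s ->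
      `|x 0 i - y 0 i| <= k%:R * (d *+ 2)].
Proof.
elim: k s => [|k IH] s kq.
  rewrite inE => /eqP ->; split=> // [y|x y].
    by rewrite inE => /eqP ->; exact: pole_sphere.
  by move=> i; rewrite !inE => /eqP -> /eqP ->; rewrite subrr normr0 mul0r.
have dbl r : r \in hemi k ++ mp antipode (hemi k) ->
  [/\ size r = k.+1, {in r, forall y, in_sphere k y} &
    forall (x y : Y) i, x \in r -> y \in r ->
      `|x 0 i - y 0 i| <= k%:R * (d *+ 2)].
  rewrite mem_cat => /orP[|/mapP[r' /IH H ->]]; first by apply: IH; lia.
  have [sr Sr cr] := H (ltnW kq); split; first by rewrite size_map.
    by move=> _ /mapP[y yr ->]; apply: antipode_sphere; exact: Sr.
  move=> x' y' i /mapP[x xr ->] /mapP[y yr ->].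
  by rewrite !mxE -opprD normrN cr.
move=> /(sweep_mem pP)[a [b [r [/and4P[a1 b1 ab1 ab2] /dbl[sr Sr cr] rs]]]].
have ptP z : z \in s -> exists2 x, x \in r & z = cone k.+1 a x \/ z = cone k.+1 b x.
  exact: pr_mem rs.
split; first by rewrite (pr_size rs) sr.
  by move=> z /ptP[x xr [] ->]; apply: cone_sphere => //; [lia|exact: Sr|lia|exact: Sr].
have cc (u v : R * R) x y i : oncircle u -> oncircle v -> `|u.1 - v.1| <= d ->
    `|u.2 - v.2| <= d -> x \in r -> y \in r ->
    `|cone k.+1 u x 0 i - cone k.+1 v y 0 i| <= k.+1%:R * (d *+ 2).
  move=> u1 v1 uv1 uv2 xr yr; rewrite !mxE eqxx /=.
  have -> (e : R) : u.1 * e + u.2 * x 0 i - (v.1 * e + v.2 * y 0 i) =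
      (u.1 - v.1) * e + (u.2 - v.2) * x 0 i + v.2 * (x 0 i - y 0 i) by ring.
  apply: (le_trans (ler_normD _ _)); rewrite -[k.+1%:R]natr1 [leRHS]mulrDl mul1r [leRHS]addrC.
  apply: lerD; last first.
    rewrite normrM; apply: le_trans (cr x y i xr yr); rewrite ler_piMl//.
    by case: (oncircle_le1 v1).
  apply: (le_trans (ler_normD _ _)); rewrite mulr2n !normrM; apply: lerD.
    apply: le_trans uv1; rewrite ler_piMr//.
    by case: eqP; rewrite ?normr1 ?normr0.
  apply: le_trans uv2; rewrite ler_piMr//; exact: sphere_le1 (Sr x xr).
move=> x' y' i /ptP[x xr [] ->] /ptP[y yr [] ->]; apply: cc => //;
  by rewrite ?subrr ?normr0// distrC.
Qed.

Lemma antipodeK l : mp antipode (mp antipode l) = l.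
Proof.
rewrite /mp -map_comp (eq_map (g := id)) ?map_id// => s /=.
by rewrite -map_comp (eq_map (g := id)) ?map_id// => y /=; rewrite /antipode opprK.
Qed.

Lemma dbl_antipode l : mp antipode (l ++ mp antipode l) === l ++ mp antipode l.
Proof. by move=> F; rewrite mp_cat antipodeK !ev_cat addrC. Qed.

(** The doubled half sphere is a cycle, by induction. Its sweep ends in itself, and starts at a
    constant map to the pole, where the two halves cancel modulo 2. *)
Lemma bd_hemi k : bd (hemi k.+1) === hemi k ++ mp antipode (hemi k).
Proof.
have step j (c := hemi j ++ mp antipode (hemi j)) :
    bd c === [::] -> bd (hemi j.+1) === c.
  move=> bc F; have := bd_sweep (cone j.+1) (1, 0) p c F.
  rewrite ev_cat (sweep_eqc _ _ _ bc) p_last ev_cat.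
  have -> : ev F (sweep (cone j.+1) (1, 0) p [::]) = 0.
    by elim: (p) (1, 0) => //= *; rewrite ?ev_nil.
  have -> : mp (cone j.+1 (0, 1)) c = c.
    rewrite /mp (eq_map (g := id)) ?map_id// => s /=.
    by rewrite (eq_map (g := id)) ?map_id// => y; rewrite /cone scale0r scale1r add0r.
  have -> : ev F (mp (cone j.+1 (1, 0)) c) = 0.
    rewrite mp_cat ev_cat -[RHS](addF2 (ev F (mp (cone j.+1 (1, 0)) (hemi j)))).
    congr (_ + ev F _); rewrite /mp -map_comp; apply: eq_map => s /=.
    by rewrite -map_comp; apply: eq_map => y; rewrite /cone /= !scale0r.
  by rewrite addr0 add0r.
elim: k => [|k IH]; apply: step => F.
  by rewrite /= !ev_cons !ev_nil addr0 addF2.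
rewrite bd_cat bd_mp ev_cat (mp_eqc antipode IH) IH.
by rewrite mp_cat antipodeK !ev_cat [X in _ + X]addrC addF2 ev_nil.
Qed.

End Hemispheres.

(** * The test cycle in the Grassmannian *)

Section Frames.
Local Open Scope quotient_scope.
Variables (R : realType) (q : nat).
Local Notation Y := 'rV[R]_(q.+2).
Local Notation Q := ((R * R) * Y)%type.
Local Notation G := (Gr R q.+2 2).
Implicit Types (y : Y) (a : R * R) (x : Q).

Let one : 'I_(q.+2) := lift ord0 ord0.

(* The frame (r e_0, r y), where r is the rotation by x.1 of the first two   *)
(* coordinates; it is only used when y is orthogonal to e_0.                 *)
Definition frame x : 'M[R]_(q.+2, 2) := \matrix_(i, j)
  if j == 0 then
    if i == 0 :> nat then x.1.1 else if i == 1%N :> nat then x.1.2 else 0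
  else
    if i == 0 :> nat then - (x.1.2 * x.2 0 one)
    else if i == 1%N :> nat then x.1.1 * x.2 0 one else x.2 0 i.

Definition valid x := oncircle x.1 /\ in_sphere q x.2.

Lemma frame_Stiefel x : valid x -> @Stiefel R q.+2 2 (frame x).
Proof.
case: x => -[c s] y [/eqP /= cs [y1 y0]].
have y00 : y 0 0 = 0 by apply: y0; rewrite subSnn.
rewrite big_ord_recl /= y00 expr0n add0r big_ord_recl -/one in y1.
rewrite /Stiefel /=; apply/matrixP => i j; rewrite !mxE !big_ord_recl -/one /=.
rewrite !mxE /=.
have E : \sum_(k < q) (frame (c, s, y))^T i (lift ord0 (lift ord0 k)) *
    frame (c, s, y) (lift ord0 (lift ord0 k)) j =
   if (i == 0) || (j == 0) then 0 else \sum_(k < q) y 0 (lift ord0 (lift ord0 k)) ^+ 2.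
  case: ifP => [ij|/negbT]; last first.
    by rewrite negb_or => /andP[/negPf i0 /negPf j0]; apply: eq_bigr => k _; rewrite !mxE i0 j0.
  rewrite big1// => k _; rewrite !mxE /=.
  by case/orP: ij => /eqP ->; rewrite eqxx ?mul0r ?mulr0.
rewrite E; set S := \sum_(k < q) _ in y1 *.
case: i j {E} => [[|[|//]] i] [[|[|//]] j] /=; rewrite ?mulr0n ?mulr1n.
- by rewrite addr0 -cs; ring.
- by ring.
- by ring.
- rewrite -y1 -[y 0 one ^+ 2]mul1r -cs; ring.
Qed.

Lemma pole_valid : valid ((1, 0), pole R q 0).
Proof.
split; first by rewrite /oncircle /= expr1n expr0n addr0.
have [p1 p0] := @pole_sphere R q 0 isT; split=> // i iq; apply: p0.
by rewrite subn0 (leq_trans iq)// leq_subr.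
Qed.

(** A default that makes [Phi] total; [Phi] is evaluated only at valid points. *)
Definition frame0 : @Stiefel R q.+2 2 :=
  exist (fun w => w \in @Stiefel R q.+2 2) _ (mem_set (frame_Stiefel pole_valid)).

Definition Phi x : G := \pi_G (insubd frame0 (frame x)).

Lemma coord_Phi x j : valid x -> coord j (Phi x) = pl (frame x) j.
Proof.
move=> xv; rewrite /Phi coord_pi insubdK//.
by apply/mem_set; exact: frame_Stiefel.
Qed.

Lemma Phi_antipode a y : valid (a, y) -> Phi (a, antipode y) = GrT (Phi (a, y)).
Proof.
move=> v; apply: coord_sep => j; rewrite coord_odd !coord_Phi//; last first.
  by case: v => a1 ys; split=> //; exact: antipode_sphere.
rewrite /pl !mxE /=.
by do ?[case: ifP => _]; ring.
Qed.

Lemma in_sphere_le k l y : (k <= l)%N -> in_sphere k y -> in_sphere l y.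
Proof.
move=> kl [y1 y0]; split=> // i il; apply: y0; apply: (leq_trans il).
by rewrite leq_sub2l.
Qed.

Lemma oncircle_1 : oncircle ((1, 0) : R * R).
Proof. by rewrite /oncircle /= expr1n expr0n addr0. Qed.

Lemma oncircle_N1 : oncircle ((-1, 0) : R * R).
Proof. by rewrite /oncircle /= sqrrN expr1n expr0n addr0. Qed.

(** The rotation by pi negates e_0 and fixes a y with vanishing first two coordinates. *)
Lemma Phi_glue y : in_sphere q.-1 y -> (0 < q)%N ->
  Phi ((-1, 0), y) = GrT (Phi ((1, 0), y)).
Proof.
move=> ys q0; have ys' := in_sphere_le (leq_pred q) ys.
have y1 : y 0 one = 0 by case: ys => _; apply; rewrite /= /bump /=; lia.
have v1 : valid ((1, 0), y) by split => //; exact: oncircle_1.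
have v2 : valid ((-1, 0), y) by split => //; exact: oncircle_N1.
apply: coord_sep => j; rewrite coord_odd !coord_Phi// /pl !mxE /= y1.
by do ?[case: ifP => _]; ring.
Qed.

(** In the top dimension the pole is e_1, which the rotation by pi negates too. The two frames are
    then negatives of each other, and -1 lies in SO(2). *)
Lemma Phi_glue_cone a y : in_sphere q.-1 y -> (0 < q)%N -> oncircle a ->
  Phi ((-1, 0), cone q a y) = Phi ((1, 0), cone q a (antipode y)).
Proof.
move=> ys q0 a1.
have qE : q.-1.+1 = q by rewrite prednK.
have y1 : y 0 one = 0 by case: ys => _; apply; rewrite /= /bump /=; lia.
have v1 : valid ((1, 0), cone q a (antipode y)).
  split; first exact: oncircle_1.
  have := @cone_sphere R q q.-1 a (antipode y) (leq_pred q) a1 (antipode_sphere ys).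
  by rewrite qE.
have v2 : valid ((-1, 0), cone q a y).
  split; first exact: oncircle_N1.
  by have := @cone_sphere R q q.-1 a y (leq_pred q) a1 ys; rewrite qE.
have iE : inord (q.+1 - q) = one by apply: val_inj; rewrite /= inordK ?subSnn.
apply: coord_sep => j; rewrite !coord_Phi// /pl !mxE /= y1 oppr0 !mulr0 !addr0.
rewrite iE -!val_eqE /=.
by case: (j.1 : nat) => [|[|k1]]; case: (j.2 : nat) => [|[|k2]] /=; ring.
Qed.

(** Entries of the frames are bounded by one and vary by at most d + e, so each of the two products
    in a minor varies by twice that. *)
Lemma coord_Phi_close d e (x z : Q) j : valid x -> valid z -> 0 <= d -> 0 <= e ->
  `|x.1.1 - z.1.1| <= d -> `|x.1.2 - z.1.2| <= d ->
  (forall i, `|x.2 0 i - z.2 0 i| <= e) ->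
  `|coord j (Phi x) - coord j (Phi z)| <= (d + e) * 4.
Proof.
move=> xv zv d0 e0 h1 h2 h3; rewrite !coord_Phi// /pl.
have prod (u v u' v' D1 D2 : R) : `|v| <= 1 -> `|u'| <= 1 ->
    `|u - u'| <= D1 -> `|v - v'| <= D2 -> `|u * v - u' * v'| <= D1 + D2.
  move=> v1 u1 uD vD.
  have -> : u * v - u' * v' = (u - u') * v + u' * (v - v') by ring.
  apply: (le_trans (ler_normD _ _)); rewrite !normrM.
  apply: lerD; first by apply: le_trans uD; rewrite ler_piMr.
  by apply: le_trans vD; rewrite ler_piMl.
have bnd (w : Q) i k : valid w -> `|frame w i k| <= 1.
  move=> [/oncircle_le1[w1 w2] ws]; have wi i' := sphere_le1 i' ws.
  rewrite mxE; case: ifP => _; case: ifP => _ //; last case: ifP => _ //.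
  - by case: ifP => _ //; rewrite normr0.
  - by rewrite normrN normrM mulr_ile1.
  - by rewrite normrM mulr_ile1.
have [[/oncircle_le1[x1 x2] xs] [/oncircle_le1[z1 z2] zs]] := (xv, zv).
have xi i := sphere_le1 i xs; have zi i := sphere_le1 i zs.
have dif i k : `|frame x i k - frame z i k| <= d + e.
  rewrite !mxE; case: ifP => _; case: ifP => _.
  - by apply: le_trans h1 _; rewrite lerDl.
  - case: ifP => _; first by apply: le_trans h2 _; rewrite lerDl.
    by rewrite subrr normr0 addr_ge0.
  - by rewrite -opprD normrN; exact: prod.
  - case: ifP => _; first exact: prod.
    by apply: le_trans (h3 i) _; rewrite lerDr.
have -> : forall u v u' v' : R, u - v - (u' - v') = (u - u') - (v - v').
  by move=> *; ring.
have -> : (d + e) * 4 = (d + e) + (d + e) + ((d + e) + (d + e)) by ring.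
apply: (le_trans (ler_normB _ _)); apply: lerD; apply: prod; auto.
Qed.

End Frames.

(** * The ladder of swept half spheres *)

Section Ladder.
Local Open Scope quotient_scope.
Variables (R : realType) (q : nat).
Hypothesis q_odd : odd q.
Local Notation Y := 'rV[R]_(q.+2).
Local Notation Q := ((R * R) * Y)%type.
Local Notation G := (Gr R q.+2 2).

Let q0 : (0 < q)%N. Proof. by case: q q_odd. Qed.

Definition place (a : R * R) (y : Y) : Q := (a, y).
Definition flipQ (x : Q) : Q := (x.1, antipode x.2).

Definition allv (l : seq (seq Q)) := forall s x, s \in l -> x \in s -> valid x.

Lemma Phi_flip l : allv l ->
  mp (@Phi R q) (mp flipQ l) = mp (@GrT R q.+2 2) (mp (@Phi R q) l).
Proof.
move=> lv; rewrite /mp -!map_comp; apply/eq_in_map => s sl /=.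
rewrite -!map_comp; apply/eq_in_map => -[a y] xs /=.
by apply: Phi_antipode; exact: lv sl xs.
Qed.

Theorem Gr_ladder e : 0 < e -> ladder (@GrT R q.+2 2) (@coord R q.+2) q.+1 e.
Proof.
(* With base mesh at most 2 q d, the bound of [coord_Phi_close] becomes 4 (2 q + 1) d = e / 2. *)
move=> e0; pose d := e / (8 * (2 * q%:R + 1)).
have K0 : 0 < 8 * (2 * q%:R + 1) :> R.
  by rewrite mulr_gt0// ltr_wpDl// mulr_ge0.
have d0 : 0 < d by rewrite divr_gt0.
have [p [pP pl]] := quarter_path d0; have [r [rP rl]] := half_path d0.
pose D := @hemi R q p; pose Z l := mp (place (1, 0)) l : seq (seq Q).
pose I l := sweep place (1, 0) r l : seq (seq Q).
(* For k < q the two ends of the sweep of [D k] contribute Z (D k) and its image under T. For odd k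
   the extra term [Z (D k.+1)] has exactly this boundary and cancels it; for even k the contribution
   is what the correction in the rung below requires. *)
pose F i := if i is k.+1 then
  I (D k) ++ (if odd k && (k < q)%N then Z (D k.+1) else [::]) else Z (D 0%N).
pose E i := mp (@Phi R q) (F i).
have Dv k s y : (k <= q)%N -> s \in D k -> y \in s -> in_sphere q y.
  move=> kq sD ys; have [_ H _] := hemi_spec (ltW d0) pP kq sD.
  by apply: in_sphere_le kq _; exact: H.
have Zv k : (k <= q)%N -> allv (Z (D k)).
  move=> kq _ _ /mapP[s sD ->] /mapP[y ys ->]; split; first exact: oncircle_1.
  exact: Dv sD ys.
have Imem k s : s \in I (D k) -> exists a b t, [/\ cstep d a b, t \in D k
    & s \in pr (place a) (place b) t] := sweep_mem rP.
have Iv k : (k <= q)%N -> allv (I (D k)).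
  move=> kq s x /Imem[a [b [t [/and4P[a1 b1 _ _] tD st]]]] xs.
  by have [y yt [] ->] := pr_mem st xs; split=> //; exact: Dv tD yt.
exists E; split; last by eexists.
  move=> i s iq /mapP[t tF ->]; rewrite size_map.
  have [st [tv tc]] : size t = i.+1 /\ {in t, forall x, valid x} /\
      (forall x z : Q, x \in t -> z \in t -> [/\ `|x.1.1 - z.1.1| <= d,
        `|x.1.2 - z.1.2| <= d & forall i, `|x.2 0 i - z.2 0 i| <= q%:R * (d *+ 2)]).
    have le_kq k : (k <= q)%N -> k%:R * (d *+ 2) <= q%:R * (d *+ 2).
      by move=> kq; rewrite ler_wpM2r ?ler_nat// mulrn_wge0// ltW.
    have HZ k : (k <= q)%N -> t \in Z (D k) -> size t = k.+1 /\ {in t, forall x, valid x} /\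
      (forall x z : Q, x \in t -> z \in t -> [/\ `|x.1.1 - z.1.1| <= d,
        `|x.1.2 - z.1.2| <= d & forall i, `|x.2 0 i - z.2 0 i| <= q%:R * (d *+ 2)]).
      move=> kq tZ; have tZ' := tZ; case/mapP: tZ => u uD tu.
      have [su Su cu] := hemi_spec (ltW d0) pP kq uD.
      split; first by rewrite tu size_map.
      split; first by move=> x xt; exact: Zv tZ' xt.
      move=> x z; rewrite tu => /mapP[x' xu ->] /mapP[z' zu ->] /=.
      rewrite !subrr normr0; split; rewrite ?ltW// => j.
      by apply: le_trans (le_kq _ kq); exact: cu.
    case: i iq tF => [|k] kq /=; first exact: (HZ 0%N).
    have {}kq : (k <= q)%N := kq.
    rewrite mem_cat => /orP[tI|]; last first.
      by case: ifP => // /andP[_ kq'] tZ; exact: HZ.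
    have [a [b [u [/and4P[a1 b1 ab1 ab2] uD tu]]]] := Imem _ _ tI.
    have [su Su cu] := hemi_spec (ltW d0) pP kq uD.
    split; first by rewrite (pr_size tu) su.
    split; first by move=> x xt; exact: Iv tI xt.
    move=> x z /(pr_mem tu)[x' xu xE] /(pr_mem tu)[z' zu zE].
    have xz j : `|x' 0 j - z' 0 j| <= q%:R * (d *+ 2).
      by apply: le_trans (le_kq _ kq); exact: cu.
    case: xE zE => -> [] -> /=; split => //;
      by [rewrite subrr normr0 ltW|rewrite distrC].
  split=> // _ _ /mapP[x xt ->] /mapP[z zt ->]; apply/closeP => j.
  have [h1 h2 h3] := tc x z xt zt.
  apply: le_lt_trans (coord_Phi_close j (tv _ xt) (tv _ zt) (ltW d0) _ h1 h2 h3) _.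
    by rewrite mulr_ge0// mulrn_wge0// ltW.
  have -> : (d + q%:R * (d *+ 2)) * 4 = e / 2.
    rewrite /d mulr2n; field; apply: lt0r_neq0.
    by have := ler0n R q; lra.
  by rewrite ltr_pdivrMr// ltr_pMr// ltr1n.
have IE k : (k <= q)%N -> bd (I (D k)) === I (bd (D k)) ++ Z (D k) ++ mp (place (-1, 0)) (D k).
  move=> kq f; have := bd_sweep place (1, 0) r (D k) f; rewrite rl !ev_cat => <-.
  by rewrite addrCA addF2 addr0.
have Idbl k : I (D k ++ mp (@antipode R q) (D k)) === I (D k) ++ mp flipQ (I (D k)).
  apply: eqc_trans (sweep_cat _ _ _ _ _) _ => f; rewrite !ev_cat; congr (_ + ev f _).
  by apply/esym; exact: sweep_equi.
have Zdbl k : Z (D k ++ mp (@antipode R q) (D k)) = Z (D k) ++ mp flipQ (Z (D k)).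
  by rewrite /Z mp_cat; congr (_ ++ _); rewrite /mp -!map_comp; apply: eq_map => s /=;
    rewrite -!map_comp.
have Zglue k : (k <= q.-1)%N ->
    mp (@Phi R q) (mp (place (-1, 0)) (D k)) = mp (@GrT R q.+2 2) (mp (@Phi R q) (Z (D k))).
  move=> kq; rewrite /Z /mp -!map_comp; apply/eq_in_map => s sD /=.
  rewrite -!map_comp; apply/eq_in_map => y ys /=; apply: Phi_glue => //.
  have kq' : (k <= q)%N by apply: leq_trans kq (leq_pred q).
  have [_ H _] := hemi_spec (ltW d0) pP kq' sD.
  by apply: in_sphere_le kq _; exact: H.
(* The half spheres of the top dimension match at both ends of the path, so *)
(* that their sweep has no boundary there; the others match up to T.        *)
have Zglue_top : mp (@Phi R q) (mp (place (-1, 0)) (D q)) === mp (@Phi R q) (Z (D q)).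
  have -> : D q = sweep (@cone R q q) (1, 0) p (D q.-1 ++ mp (@antipode R q) (D q.-1)).
    by have hemiS k : (0 < k)%N -> D k =
        sweep (@cone R q k) (1, 0) p (D k.-1 ++ mp (@antipode R q) (D k.-1));
      [case: k|exact: hemiS].
  rewrite /Z !mp_sweep; set c := D q.-1 ++ _.
  have cS s y : s \in c -> y \in s -> in_sphere q.-1 y.
    have H s' : s' \in D q.-1 -> {in s', forall y, in_sphere q.-1 y}.
      by move=> sD; case: (hemi_spec (ltW d0) pP (leq_pred q) sD).
    rewrite mem_cat => /orP[sD ys|/mapP[s' sD ->] /mapP[y' ys ->]]; first exact: H ys.
    by apply: antipode_sphere; exact: H ys.
  have pC a : a \in (1, 0) :: p -> oncircle a.
    rewrite inE => /orP[/eqP ->|ap]; first exact: oncircle_1.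
    by case/splitPr: ap pP => p1 p2; rewrite cat_path /= => /and3P[_ /and4P[]].
  pose g a y := Phi (place (1, 0) (@cone R q q a y)).
  (* The end at angle pi is the cone over the antipodal base, and the base is a doubled chain, hence
     symmetric under the antipode. *)
  rewrite (@eq_sweep _ _ _ _ (fun a y => g a (antipode y))); last first.
    by move=> a s y ap sc ys; apply: Phi_glue_cone; [exact: cS sc ys| |exact: pC].
  apply: eqc_trans (_ : sweep g (1, 0) p (mp (@antipode R q) c) === _).
    have := @sweep_equi _ _ _ _ (@antipode R q) id _
      (fun a y => g a (antipode y)) g (1, 0) p c.
    rewrite /mp (eq_map (g := id)) ?map_id => [-> //|s]; exact: map_id.
  exact: sweep_eqc (dbl_antipode _).
move=> k kq f; have {}kq : (k <= q)%N := kq.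
have Pflip l : allv l ->
  ev f (mp (@Phi R q) (mp flipQ l)) = ev f (mp (@GrT R q.+2 2) (mp (@Phi R q) l)).
  by move=> lv; rewrite Phi_flip.
pose PZ := ev f (mp (@Phi R q) (Z (D k))).
pose TZ := ev f (mp (@GrT R q.+2 2) (mp (@Phi R q) (Z (D k)))).
have bX : ev f (mp (@Phi R q) (bd (if odd k && (k < q)%N then Z (D k.+1) else [::]))) =
    if odd k && (k < q)%N then PZ + TZ else 0.
  case: ifP => _; last by rewrite ev_nil.
  have -> : bd (Z (D k.+1)) = Z (bd (D k.+1)) by exact: bd_mp.
  have ZE : Z (bd (D k.+1)) === Z (D k) ++ mp flipQ (Z (D k)).
    by rewrite -Zdbl; apply: mp_eqc; exact: bd_hemi pl k.
  by rewrite (mp_eqc _ ZE) mp_cat ev_cat Pflip//; exact: Zv.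
have bI : ev f (mp (@Phi R q) (bd (I (D k)))) =
  ev f (mp (@Phi R q) (I (bd (D k)))) + (PZ + if k == q then PZ else TZ).
  rewrite (mp_eqc _ (IE k kq)) !mp_cat !ev_cat; congr (_ + (_ + _)).
  rewrite /PZ /TZ; have [->|kq'] := eqVneq k q; first exact: Zglue_top.
  by rewrite Zglue//; move: kq kq'; lia.
rewrite /E bd_mp /F -/(F k) bd_cat mp_cat ev_cat bX bI ev_cat.
(* For k = 0 the boundary of the point is the empty tuple, whose sweep is empty. *)
case: (k) kq @PZ @TZ {bX bI} => [|j] jq PZ TZ /=.
  have -> : ev f (mp (@Phi R q) (I [:: [::]])) = 0.
    suff -> : I [:: [::]] = [::] by rewrite ev_nil.
    by rewrite /I; elim: (r) (1, 0) => //= b r' IH a; rewrite IH.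
  by rewrite add0r addr0 ltn_eqF.
have -> : ev f (mp (@Phi R q) (I (bd (D j.+1)))) =
    ev f (mp (@Phi R q) (I (D j))) + ev f (mp (@GrT R q.+2 2) (mp (@Phi R q) (I (D j)))).
  have IE1 : I (bd (D j.+1)) === I (D j) ++ mp flipQ (I (D j)).
    by apply: eqc_trans (Idbl j); apply: sweep_eqc; exact: bd_hemi pl j.
  by rewrite (mp_eqc _ IE1) mp_cat ev_cat Pflip//; apply: Iv; exact: ltnW.
rewrite !mp_cat !ev_cat jq andbT.
set u := ev _ _; set v := ev _ _.
have -> : ev f (mp (@Phi R q) (if odd j then Z (D j.+1) else [::])) =
  if odd j then PZ else 0 by case: ifP; rewrite ?ev_nil.
have -> : ev f (mp (@GrT R q.+2 2) (mp (@Phi R q) (if odd j then Z (D j.+1) else [::]))) =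
  if odd j then TZ else 0 by case: ifP; rewrite ?ev_nil.
(* In the top dimension the ends cancel, so the rung below must carry no correction: j = q - 1 has
   to be even. *)
have [jE|jN] := eqVneq j.+1 q.
  have -> : odd j = false by move: q_odd; rewrite -jE /=; case: odd.
  by rewrite jE ltnn /= addF2 !addr0.
have -> : (j.+1 < q)%N by rewrite ltn_neqAle jN.
case: (odd j) => /=; last first.
  by rewrite !addr0 -addrA addF2 addr0.
by rewrite addr0 addrACA.
Qed.

End Ladder.

Theorem corollary1p4 (R : realType) (n m : nat)
    (n_ge3 : (3 <= n)%N) (n_odd : odd n) (m_range : (1 <= m <= n - 1)%N)
    (f : Gr R n 2 -> 'rV[R]_m) (f_cont : continuous f) :
  let Z := [set P : Gr R n 2 | f (GrT P) = f P] in
  exists TZ : @GrT R n 2 @` Z = Z,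
    is_Tspace (restrictT TZ) /\
    exists2 k, is_Yang_index (restrictT TZ) k & (n - m - 1 <= k)%N.
Proof.
move=> Z; case: n => [|[|q]] // in n_ge3 n_odd m_range f f_cont Z *.
have q_odd : odd q by move: n_odd; rewrite /= negbK.
have TZ : @GrT R q.+2 2 @` Z = Z.
  rewrite eqEsubset; split=> [_ [P PZ <-]|P PZ]; first by rewrite /Z /= GrTK.
  by exists (GrT P); rewrite /Z /= GrTK.
exists TZ.
(* These m functions are odd, and their common zero set is [Z]. *)
pose h (i : 'I_m) (P : Gr R q.+2 2) := f (GrT P) 0 i - f P 0 i.
have coord_f i : continuous (fun P => f P 0 i).
  move=> P; apply: (@continuous_comp _ _ _ f (fun v : 'rV[R]_m => v 0 i)).
    exact: f_cont.
  exact: coord_continuous.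
have T_cont : continuous (@GrT R q.+2 2).
  apply: (T_continuous (@Gr_compact R q.+2) (@coord_continuous_Gr R q.+2)).
    exact: coord_odd.
  exact: coord_sep.
have h_cont i : continuous (h i).
  move=> P; apply: continuousB; last exact: coord_f.
  by apply: (@continuous_comp _ _ _ (@GrT R q.+2 2) (fun P => f P 0 i)); [exact: T_cont|exact: coord_f].
have h_odd i P : h i (GrT P) = - h i P by rewrite /h GrTK opprB.
have ZE P : Z P <-> forall i, h i P = 0.
  split=> [PZ i|H]; first by rewrite /h PZ subrr.
  by apply/rowP => i; apply/eqP; rewrite -subr_eq0; apply/eqP; exact: H.
have mN : (m <= q.+1)%N by case/andP: m_range; rewrite subn1.
have [sp [k kY kN]] := yang (@Gr_compact R q.+2) (@coord_continuous_Gr R q.+2)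
  (@coord_odd R q.+2) (@coord_sep R q.+2) (@coord_neq0 R q.+2) h_cont mN h_odd
  (@Gr_ladder R q q_odd) TZ ZE.
by split=> //; exists k => //; apply: leq_trans kN; lia.
Qed.
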